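(* Let $\mathsf{C}$ be a strict braided monoidal category and let $\pi:A\to H$ be an invertible 1-cocycle in $\mathsf{C}$ with action $\phi_H$. Then the category ${}_{(\pi,\phi_H)}\mathsf{Mod}$ of left modules over the invertible 1-cocycle $\pi:A\to H$ and the category ${}_{\mathbb{H}_\pi}\mathsf{Mod}$ of left modules over the Hopf brace $\mathbb{H}_\pi$ induced by $\pi$ are equivalent.
   Context: $\mathsf{C}$ is a strict braided monoidal category with tensor product $\otimes$, unit object $K$ and braiding $c$. For an object $P$ and a morphism $f$, one writes $P\otimes f$ for $id_P\otimes f$ and $f\otimes P$ for $f\otimes id_P$. A Hopf algebra $H$ in $\mathsf{C}$ has unit $\eta_H$, product $\mu_H$, counit $\varepsilon_H$, coproduct $\delta_H$ and antipode $\lambda_H$ (the convolution inverse of $id_H$), where the tensor product of algebras (coalgebras) is an algebra (coalgebra) via the braiding $c$. Left modules over an algebra and their morphisms are the usual ones. Module algebra: for a Hopf algebra $D$, an algebra $B$ is a left $D$-module algebra with action $\phi_B:D\otimes B\to B$ if $(B,\phi_B)$ is a left $D$-module, $\phi_B\circ(D\otimes\eta_B)=\varepsilon_D\otimes\eta_B$ and $\phi_B\circ(D\otimes\mu_B)=\mu_B\circ(\phi_B\otimes\phi_B)\circ(D\otimes c_{D,B}\otimes B)\circ(\delta_D\otimes B\otimes B)$. Invertible 1-cocycle: let $A,H$ be Hopf algebras in $\mathsf{C}$ such that $H$ is a left $A$-module algebra with action $\phi_H$. A coalgebra morphism $\pi:A\to H$ is an invertible 1-cocycle (with action $\phi_H$)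 if it is an isomorphism and $\pi\circ\mu_A=\mu_H\circ(\pi\otimes\phi_H)\circ(\delta_A\otimes\pi)$. A left module over an invertible 1-cocycle $\pi:A\to H$ with action $\phi_H$ is a 6-tuple $(M,N,\phi_M,\varphi_M,\phi_N,\gamma)$ where: (i) $(M,\phi_M)$ is a left $A$-module, $(M,\varphi_M)$ is a left $H$-module and $\phi_M\circ(A\otimes\varphi_M)=\varphi_M\circ(\phi_H\otimes\phi_M)\circ(A\otimes c_{A,H}\otimes M)\circ(\delta_A\otimes H\otimes M)$; (ii) $(N,\phi_N)$ is a left $A$-module; (iii) $\gamma:N\to M$ is an isomorphism in $\mathsf{C}$ with $\gamma\circ\phi_N=\varphi_M\circ(\pi\otimes\phi_M)\circ(\delta_A\otimes\gamma)$. A morphism $(M,N,\phi_M,\varphi_M,\phi_N,\gamma)\to(M',N',\phi_{M'},\varphi_{M'},\phi_{N'},\gamma')$ is a pair $(h,l)$ with $h:M\to M'$ a morphism of left $A$-modules and of left $H$-modules, $l:N\to N'$ a morphism of left $A$-modules and $h\circ\gamma=\gamma'\circ l$. These form the category ${}_{(\pi,\phi_H)}\mathsf{Mod}$. Hopf brace: let $(H,\varepsilon_H,\delta_H)$ be a coalgebra with two algebra structures $(H,\eta_H^1,\mu_H^1)$, $(H,\eta_H^2,\mu_H^2)$ and endomorphisms $\lambda_H^1,\lambda_H^2$ of $H$. These data form a Hopf brace $\mathbb{H}=(H_1,H_2)$ if $H_i=(H,\eta_H^i,\mu_H^i,\varepsilon_H,\delta_H,\lambda_H^i)$ is a Hopf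 algebra in $\mathsf{C}$ for $i=1,2$ and $$\mu_H^2\circ(H\otimes\mu_H^1)=\mu_H^1\circ(\mu_H^2\otimes\Gamma_{H_1})\circ(H\otimes c_{H,H}\otimes H)\circ(\delta_H\otimes H\otimes H),$$ where $\Gamma_{H_1}=\mu_H^1\circ(\lambda_H^1\otimes\mu_H^2)\circ(\delta_H\otimes H)$. Left $\mathbb{H}$-module: a triple $(M,\psi_M^1,\psi_M^2)$ where $(M,\psi_M^1)$ is a left $H_1$-module, $(M,\psi_M^2)$ is a left $H_2$-module and $$\psi_M^2\circ(H\otimes\psi_M^1)=\psi_M^1\circ(\mu_H^2\otimes\Gamma_M)\circ(H\otimes c_{H,H}\otimes M)\circ(\delta_H\otimes H\otimes M),$$ where $\Gamma_M=\psi_M^1\circ(\lambda_H^1\otimes\psi_M^2)\circ(\delta_H\otimes M)$. Morphisms of left $\mathbb{H}$-modules are morphisms in $\mathsf{C}$ that are morphisms of left $H_1$-modules and of left $H_2$-modules; the resulting category is ${}_{\mathbb{H}}\mathsf{Mod}$. The Hopf brace $\mathbb{H}_\pi$: for an invertible 1-cocycle $\pi:A\to H$, put $\eta_{H_\pi}=\eta_H$, $\mu_{H_\pi}=\pi\circ\mu_A\circ(\pi^{-1}\otimes\pi^{-1})$ and $\lambda_{H_\pi}=\pi\circ\lambda_A\circ\pi^{-1}$. Then $\mathbb{H}_\pi=(H,H_\pi)$ is the Hopf brace with coalgebra $(H,\varepsilon_H,\delta_H)$, first structure $(\eta_H,\mu_H,\lambda_H)$ and second structure $(\eta_{H_\pi},\mu_{H_\pi},\lambda_{H_\pi})$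 (it is known that this is a Hopf brace). *)

(* Defs.v *)
From Stdlib Require Import ProofIrrelevance Classical ClassicalEpsilon.
From mathcomp Require Import ssreflect ssrfun.

Set Implicit Arguments.
Unset Strict Implicit.
Unset Printing Implicit Defensive.

Declare Scope cat_scope.
Delimit Scope cat_scope with cat.
Local Open Scope cat_scope.

Reserved Notation "X ⊗ Y" (at level 39, right associativity).
Reserved Notation "f ⊠ g" (at level 39, right associativity).
Reserved Notation "g ∘ f" (at level 40, left associativity).
Reserved Notation "f ≗ g" (at level 70, no associativity).

Record category := Category {
  obj :> Type;
  hom : obj -> obj -> Type;
  idm : forall X, hom X X;
  comp : forall X Y Z, hom Y Z -> hom X Y -> hom X Z;
  comp1m : forall X Y (f : hom X Y), comp (idm Y) f = f;
  compm1 : forall X Y (f : hom X Y), comp f (idm X) = f;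
  compA : forall X Y Z T (h : hom Z T) (g : hom Y Z) (f : hom X Y),
    comp h (comp g f) = comp (comp h g) f
}.
Arguments hom {c} X Y.
Arguments idm {c} X.
Arguments comp {c X Y Z} g f.

Record iso (C : category) (X Y : C) := Iso {
  iso_hom :> hom X Y;
  iso_inv : hom Y X;
  iso_homK : comp iso_inv iso_hom = idm X;
  iso_invK : comp iso_hom iso_inv = idm Y
}.
Arguments iso {C} X Y.

Record functor (C D : category) := Functor {
  fobj :> C -> D;
  fmap : forall X Y : C, hom X Y -> hom (fobj X) (fobj Y);
  fmap1 : forall X : C, fmap (idm X) = idm (fobj X);
  fmapM : forall (X Y Z : C) (g : hom Y Z) (f : hom X Y),
    fmap (comp g f) = comp (fmap g) (fmap f)
}.
Arguments fmap {C D} _ {X Y} _.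

Definition functor_id (C : category) : functor C C :=
  @Functor C C (fun X => X) (fun X Y f => f) (fun X => erefl) (fun X Y Z g f => erefl).

Lemma functor_comp1 (C D E : category) (G : functor D E) (F : functor C D) (X : C) :
  fmap G (fmap F (idm X)) = idm (G (F X)).
Proof. by rewrite !fmap1. Qed.

Lemma functor_compM (C D E : category) (G : functor D E) (F : functor C D)
    (X Y Z : C) (g : hom Y Z) (f : hom X Y) :
  fmap G (fmap F (comp g f)) = comp (fmap G (fmap F g)) (fmap G (fmap F f)).
Proof. by rewrite !fmapM. Qed.

Definition functor_comp (C D E : category) (G : functor D E) (F : functor C D) : functor C E :=
  Functor (functor_comp1 G F) (@functor_compM C D E G F).

Record nat_iso (C D : category) (F G : functor C D) := NatIso {
  ni_comp :> forall X : C, iso (F X) (G X);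
  ni_nat : forall (X Y : C) (f : hom X Y),
    comp (ni_comp Y) (fmap F f) = comp (fmap G f) (ni_comp X)
}.

Definition equivalent_categories (C D : category) : Prop :=
  exists (F : functor C D) (G : functor D C),
    inhabited (nat_iso (functor_comp G F) (functor_id C)) /\
    inhabited (nat_iso (functor_comp F G) (functor_id D)).

Definition cast_hom (C : category) (X X' Y Y' : C) (eX : X = X') (eY : Y = Y') :
    hom X Y -> hom X' Y' :=
  match eX in _ = X1, eY in _ = Y1 return hom X Y -> hom X1 Y1 with
  | erefl, erefl => fun f => f
  end.
Arguments cast_hom : simpl never.

Record strict_monoidal := StrictMonoidal {
  sm_cat :> category;
  tens : sm_cat -> sm_cat -> sm_cat;
  unit_obj : sm_cat;
  tensA : forall X Y Z, tens X (tens Y Z) = tens (tens X Y) Z;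
  tens1o : forall X, tens unit_obj X = X;
  tenso1 : forall X, tens X unit_obj = X;
  tensm : forall X X' Y Y',
    hom X X' -> hom Y Y' -> hom (tens X Y) (tens X' Y');
  tensm_id : forall X Y, tensm (idm X) (idm Y) = idm (tens X Y);
  tensm_comp : forall X X' X'' Y Y' Y'' (f' : hom X' X'') (f : hom X X')
      (g' : hom Y' Y'') (g : hom Y Y'),
    tensm (comp f' f) (comp g' g) = comp (tensm f' g') (tensm f g);
  tensmA : forall X X' Y Y' Z Z' (f : hom X X') (g : hom Y Y') (h : hom Z Z'),
    cast_hom (tensA X Y Z) (tensA X' Y' Z') (tensm f (tensm g h)) =
    tensm (tensm f g) h;
  tens1m : forall X X' (f : hom X X'),
    cast_hom (tens1o X) (tens1o X') (tensm (idm unit_obj) f) = f;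
  tensm1 : forall X X' (f : hom X X'),
    cast_hom (tenso1 X) (tenso1 X') (tensm f (idm unit_obj)) = f
}.
Arguments tens {s} X Y.
Arguments unit_obj {s}.
Arguments tensm {s X X' Y Y'} f g.

Notation "X ⊗ Y" := (tens X Y) : cat_scope.
Notation "f ⊠ g" := (tensm f g) : cat_scope.
Notation K := unit_obj.

(* In a strict monoidal category X ⊗ (Y ⊗ Z) and (X ⊗ Y) ⊗ Z are equal, but not
   convertible.  [g ∘ f] composes morphisms whose middle objects agree up to such
   an equality, and [f ≗ g] compares morphisms whose sources and targets do; the
   equalities of objects are found by type class resolution.  Which proof is
   found is immaterial by proof irrelevance. *)
Class obj_eq (C : category) (X Y : C) : Prop := obj_eq_pf : X = Y.
Arguments obj_eq_pf {C X Y _}.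

Ltac strict_obj :=
  unfold obj_eq; repeat first [rewrite tens1o | rewrite tenso1 | rewrite tensA];
  exact (eq_refl _).
#[export] Hint Extern 0 (obj_eq _ _) => exact (eq_refl _) : typeclass_instances.
#[export] Hint Extern 1 (obj_eq _ _) => strict_obj : typeclass_instances.

Definition scomp (C : category) (X Y Y' Z : C) (e : obj_eq Y Y')
    (g : hom Y' Z) (f : hom X Y) : hom X Z :=
  comp g (cast_hom erefl obj_eq_pf f).
Arguments scomp {C X Y Y' Z e} g f.
Notation "g ∘ f" := (scomp g f) : cat_scope.

Definition eqm (C : category) (X X' Y Y' : C) (eX : obj_eq X X') (eY : obj_eq Y Y')
    (f : hom X Y) (g : hom X' Y') : Prop :=
  cast_hom (@obj_eq_pf _ _ _ eX) (@obj_eq_pf _ _ _ eY) f = g.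
Arguments eqm {C X X' Y Y' eX eY} f g.
Notation "f ≗ g" := (eqm f g) : cat_scope.

Record strict_braided := StrictBraided {
  sb_mon :> strict_monoidal;
  braid : forall X Y : sb_mon, iso (X ⊗ Y) (Y ⊗ X);
  braid_nat : forall (X X' Y Y' : sb_mon) (f : hom X X') (g : hom Y Y'),
    braid X' Y' ∘ (f ⊠ g) = (g ⊠ f) ∘ braid X Y;
  braid_tensr : forall X Y Z : sb_mon,
    braid X (Y ⊗ Z) ≗ (idm Y ⊠ braid X Z) ∘ (braid X Y ⊠ idm Z);
  braid_tensl : forall X Y Z : sb_mon,
    braid (X ⊗ Y) Z ≗ (braid X Z ⊠ idm Y) ∘ (idm X ⊠ braid Y Z)
}.
Arguments braid {s} X Y.

Record algebra_on (C : strict_monoidal) (B : C) := AlgebraOn {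
  eta : hom K B;
  mu : hom (B ⊗ B) B;
  mu1m : mu ∘ (eta ⊠ idm B) ≗ idm B;
  mum1 : mu ∘ (idm B ⊠ eta) ≗ idm B;
  muA : mu ∘ (idm B ⊠ mu) ≗ mu ∘ (mu ⊠ idm B)
}.

Record coalgebra_on (C : strict_monoidal) (D : C) := CoalgebraOn {
  eps : hom D K;
  delta : hom D (D ⊗ D);
  delta1m : (eps ⊠ idm D) ∘ delta ≗ idm D;
  deltam1 : (idm D ⊠ eps) ∘ delta ≗ idm D;
  deltaA : (idm D ⊠ delta) ∘ delta ≗ (delta ⊠ idm D) ∘ delta
}.

Record hopf_on (C : strict_braided) (H : C) (coH : coalgebra_on H) := HopfOn {
  hopf_alg :> algebra_on H;
  antipode : hom H H;
  eps_eta : eps coH ∘ eta hopf_alg = idm K;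
  eps_mu : eps coH ∘ mu hopf_alg ≗ eps coH ⊠ eps coH;
  delta_eta : delta coH ∘ eta hopf_alg ≗ eta hopf_alg ⊠ eta hopf_alg;
  delta_mu : delta coH ∘ mu hopf_alg =
    (mu hopf_alg ⊠ mu hopf_alg) ∘ (idm H ⊠ braid H H ⊠ idm H)
      ∘ (delta coH ⊠ delta coH);
  antipodel : mu hopf_alg ∘ (antipode ⊠ idm H) ∘ delta coH = eta hopf_alg ∘ eps coH;
  antipoder : mu hopf_alg ∘ (idm H ⊠ antipode) ∘ delta coH = eta hopf_alg ∘ eps coH
}.

Record hopf_algebra (C : strict_braided) := HopfAlgebra {
  carrier :> C;
  coalg : coalgebra_on carrier;
  hopf : hopf_on coalg
}.

Definition ηof (C : strict_braided) (H : hopf_algebra C) := eta (hopf H).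
Definition μof (C : strict_braided) (H : hopf_algebra C) := mu (hopf H).
Definition εof (C : strict_braided) (H : hopf_algebra C) := eps (coalg H).
Definition δof (C : strict_braided) (H : hopf_algebra C) := delta (coalg H).
Definition λof (C : strict_braided) (H : hopf_algebra C) := antipode (hopf H).

Notation "'η[' H ]" := (ηof H) (at level 0, format "'η[' H ]") : cat_scope.
Notation "'μ[' H ]" := (μof H) (at level 0, format "'μ[' H ]") : cat_scope.
Notation "'ε[' H ]" := (εof H) (at level 0, format "'ε[' H ]") : cat_scope.
Notation "'δ[' H ]" := (δof H) (at level 0, format "'δ[' H ]") : cat_scope.
Notation "'λ[' H ]" := (λof H) (at level 0, format "'λ[' H ]") : cat_scope.

Definition is_lmodule (C : strict_monoidal) (B : C) (algB : algebra_on B)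
    (M : C) (act : hom (B ⊗ M) M) : Prop :=
  act ∘ (eta algB ⊠ idm M) ≗ idm M /\
  act ∘ (idm B ⊠ act) ≗ act ∘ (mu algB ⊠ idm M).

Definition is_lmodule_mor (C : strict_monoidal) (B M M' : C)
    (act : hom (B ⊗ M) M) (act' : hom (B ⊗ M') M') (h : hom M M') : Prop :=
  h ∘ act = act' ∘ (idm B ⊠ h).

Lemma is_lmodule_mor_id (C : strict_monoidal) (B M : C) (act : hom (B ⊗ M) M) :
  is_lmodule_mor act act (idm M).
Proof.
rewrite /is_lmodule_mor /scomp /=.
by rewrite comp1m tensm_id compm1.
Qed.

Lemma is_lmodule_mor_comp (C : strict_monoidal) (B M M' M'' : C)
    (act : hom (B ⊗ M) M) (act' : hom (B ⊗ M') M') (act'' : hom (B ⊗ M'') M'')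
    (h' : hom M' M'') (h : hom M M') :
  is_lmodule_mor act' act'' h' -> is_lmodule_mor act act' h ->
  is_lmodule_mor act act'' (comp h' h).
Proof.
rewrite /is_lmodule_mor /scomp /= => E' E.
rewrite -compA E compA E' -compA; congr comp.
by rewrite -tensm_comp comp1m.
Qed.

Record module_algebra (C : strict_braided) (D B : hopf_algebra C) := ModuleAlgebra {
  ma_act :> hom (D ⊗ B) B;
  ma_lmodule : is_lmodule (hopf D) ma_act;
  ma_unit : ma_act ∘ (idm D ⊠ η[B]) ≗ ε[D] ⊠ η[B];
  ma_mul : ma_act ∘ (idm D ⊠ μ[B]) ≗
    μ[B] ∘ (ma_act ⊠ ma_act) ∘ (idm D ⊠ braid D B ⊠ idm B)
      ∘ (δ[D] ⊠ idm B ⊠ idm B)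
}.

Record inv_cocycle (C : strict_braided) (A H : hopf_algebra C)
    (phiH : module_algebra A H) := InvCocycle {
  ic_iso :> iso (carrier A) (carrier H);
  ic_eps : ε[H] ∘ ic_iso = ε[A];
  ic_delta : δ[H] ∘ ic_iso = (ic_iso ⊠ ic_iso) ∘ δ[A];
  ic_mul : ic_iso ∘ μ[A] = μ[H] ∘ (ic_iso ⊠ phiH) ∘ (δ[A] ⊠ ic_iso)
}.

Section CocycleModules.
Variables (C : strict_braided) (A H : hopf_algebra C).
Variables (phiH : module_algebra A H) (pi : inv_cocycle phiH).

Record cocycle_module := CocycleModule {
  cm_M : C;
  cm_N : C;
  cm_phiM : hom (A ⊗ cm_M) cm_M;
  cm_varphiM : hom (H ⊗ cm_M) cm_M;
  cm_phiN : hom (A ⊗ cm_N) cm_N;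
  cm_gamma : iso cm_N cm_M;
  cm_phiM_lmod : is_lmodule (hopf A) cm_phiM;
  cm_varphiM_lmod : is_lmodule (hopf H) cm_varphiM;
  cm_compat : cm_phiM ∘ (idm A ⊠ cm_varphiM) =
    cm_varphiM ∘ (phiH ⊠ cm_phiM) ∘ (idm A ⊠ braid A H ⊠ idm cm_M)
      ∘ (δ[A] ⊠ idm H ⊠ idm cm_M);
  cm_phiN_lmod : is_lmodule (hopf A) cm_phiN;
  cm_gamma_mul : cm_gamma ∘ cm_phiN =
    cm_varphiM ∘ (pi ⊠ cm_phiM) ∘ (δ[A] ⊠ cm_gamma)
}.

Record cocycle_module_hom (X Y : cocycle_module) := CocycleModuleHom {
  cmh_h : hom (cm_M X) (cm_M Y);
  cmh_l : hom (cm_N X) (cm_N Y);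
  cmh_phiM : is_lmodule_mor (cm_phiM X) (cm_phiM Y) cmh_h;
  cmh_varphiM : is_lmodule_mor (cm_varphiM X) (cm_varphiM Y) cmh_h;
  cmh_phiN : is_lmodule_mor (cm_phiN X) (cm_phiN Y) cmh_l;
  cmh_gamma : cmh_h ∘ cm_gamma X = cm_gamma Y ∘ cmh_l
}.

Lemma cocycle_module_hom_eq (X Y : cocycle_module) (f g : cocycle_module_hom X Y) :
  cmh_h f = cmh_h g -> cmh_l f = cmh_l g -> f = g.
Proof.
case: f => h l p1 p2 p3 p4; case: g => h' l' q1 q2 q3 q4 /= E1 E2.
subst h' l'; congr CocycleModuleHom; exact: proof_irrelevance.
Qed.

Lemma cocycle_module_id_gamma (X : cocycle_module) :
  idm (cm_M X) ∘ cm_gamma X = cm_gamma X ∘ idm (cm_N X).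
Proof. by rewrite /scomp /= comp1m compm1. Qed.

Definition cocycle_module_id (X : cocycle_module) : cocycle_module_hom X X :=
  CocycleModuleHom (is_lmodule_mor_id _) (is_lmodule_mor_id _)
    (is_lmodule_mor_id _) (cocycle_module_id_gamma X).

Lemma cocycle_module_comp_gamma (X Y Z : cocycle_module)
    (g : cocycle_module_hom Y Z) (f : cocycle_module_hom X Y) :
  comp (cmh_h g) (cmh_h f) ∘ cm_gamma X = cm_gamma Z ∘ comp (cmh_l g) (cmh_l f).
Proof.
move: (cmh_gamma g) (cmh_gamma f); rewrite /scomp /= => Eg Ef.
by rewrite -compA Ef compA Eg -compA.
Qed.

Definition cocycle_module_comp (X Y Z : cocycle_module)
    (g : cocycle_module_hom Y Z) (f : cocycle_module_hom X Y) :
    cocycle_module_hom X Z :=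
  CocycleModuleHom (is_lmodule_mor_comp (cmh_phiM g) (cmh_phiM f))
    (is_lmodule_mor_comp (cmh_varphiM g) (cmh_varphiM f))
    (is_lmodule_mor_comp (cmh_phiN g) (cmh_phiN f))
    (cocycle_module_comp_gamma g f).

Definition cocycle_module_cat : category.
Proof.
refine (@Category cocycle_module cocycle_module_hom cocycle_module_id
  cocycle_module_comp _ _ _).
- by move=> X Y f; apply: cocycle_module_hom_eq; rewrite /= comp1m.
- by move=> X Y f; apply: cocycle_module_hom_eq; rewrite /= compm1.
- by move=> X Y Z T h g f; apply: cocycle_module_hom_eq; rewrite /= compA.
Defined.

End CocycleModules.

(* The morphism Γ_M; Γ_{H_1} is the case psi1 = μ¹, psi2 = μ². *)
Definition gamma_act (C : strict_monoidal) (H : C) (coH : coalgebra_on H)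
    (lam : hom H H) (M : C) (psi1 psi2 : hom (H ⊗ M) M) : hom (H ⊗ M) M :=
  psi1 ∘ (lam ⊠ psi2) ∘ (delta coH ⊠ idm M).

Definition hopf_brace_law (C : strict_braided) (H : C) (coH : coalgebra_on H)
    (H1 H2 : hopf_on coH) : Prop :=
  mu H2 ∘ (idm H ⊠ mu H1) =
  mu H1 ∘ (mu H2 ⊠ gamma_act coH (antipode H1) (mu H1) (mu H2))
    ∘ (idm H ⊠ braid H H ⊠ idm H) ∘ (delta coH ⊠ idm H ⊠ idm H).

Record hopf_brace (C : strict_braided) := HopfBrace {
  hb_carrier :> C;
  hb_coalg : coalgebra_on hb_carrier;
  hb_1 : hopf_on hb_coalg;
  hb_2 : hopf_on hb_coalg;
  hb_law : hopf_brace_law hb_1 hb_2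
}.

Section BraceModules.
Variables (C : strict_braided) (H : hopf_brace C).

Record brace_module := BraceModule {
  bm_M :> C;
  bm_psi1 : hom (H ⊗ bm_M) bm_M;
  bm_psi2 : hom (H ⊗ bm_M) bm_M;
  bm_psi1_lmod : is_lmodule (hb_1 H) bm_psi1;
  bm_psi2_lmod : is_lmodule (hb_2 H) bm_psi2;
  bm_compat : bm_psi2 ∘ (idm H ⊠ bm_psi1) =
    bm_psi1 ∘ (mu (hb_2 H) ⊠
               gamma_act (hb_coalg H) (antipode (hb_1 H)) bm_psi1 bm_psi2)
      ∘ (idm H ⊠ braid H H ⊠ idm bm_M) ∘ (delta (hb_coalg H) ⊠ idm H ⊠ idm bm_M)
}.

Record brace_module_hom (X Y : brace_module) := BraceModuleHom {
  bmh_h :> hom (bm_M X) (bm_M Y);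
  bmh_psi1 : is_lmodule_mor (bm_psi1 X) (bm_psi1 Y) bmh_h;
  bmh_psi2 : is_lmodule_mor (bm_psi2 X) (bm_psi2 Y) bmh_h
}.

Lemma brace_module_hom_eq (X Y : brace_module) (f g : brace_module_hom X Y) :
  bmh_h f = bmh_h g -> f = g.
Proof.
case: f => h p1 p2; case: g => h' q1 q2 /= E.
subst h'; congr BraceModuleHom; exact: proof_irrelevance.
Qed.

Definition brace_module_id (X : brace_module) : brace_module_hom X X :=
  BraceModuleHom (is_lmodule_mor_id _) (is_lmodule_mor_id _).

Definition brace_module_comp (X Y Z : brace_module)
    (g : brace_module_hom Y Z) (f : brace_module_hom X Y) : brace_module_hom X Z :=
  BraceModuleHom (is_lmodule_mor_comp (bmh_psi1 g) (bmh_psi1 f))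
    (is_lmodule_mor_comp (bmh_psi2 g) (bmh_psi2 f)).

Definition brace_module_cat : category.
Proof.
refine (@Category brace_module brace_module_hom brace_module_id
  brace_module_comp _ _ _).
- by move=> X Y f; apply: brace_module_hom_eq; rewrite /= comp1m.
- by move=> X Y f; apply: brace_module_hom_eq; rewrite /= compm1.
- by move=> X Y Z T h g f; apply: brace_module_hom_eq; rewrite /= compA.
Defined.

End BraceModules.

(* Packing morphisms with their source and target turns the equations that hold
   up to equality of objects into Leibniz equations, without casts. *)
Section Arrows.
Variable C : strict_braided.

Record arrow := Arrow { src : C; tgt : C; mor : hom src tgt }.

Definition pk (X Y : C) (f : hom X Y) : option arrow := Some (Arrow f).

Definition acomp (a b : option arrow) : option arrow :=
  match a, b with
  | Some a, Some b =>
    match excluded_middle_informative (tgt b = src a) with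
    | left e => pk (comp (mor a) (cast_hom erefl e (mor b)))
    | right _ => None
    end
  | _, _ => None
  end.

Definition atens (a b : option arrow) : option arrow :=
  match a, b with
  | Some a, Some b => pk (tensm (mor a) (mor b))
  | _, _ => None
  end.

Definition typed (a : option arrow) (X Y : C) : Prop := exists f : hom X Y, a = pk f.

Lemma pk_cast (X X' Y Y' : C) (eX : X = X') (eY : Y = Y') (f : hom X Y) :
  pk (cast_hom eX eY f) = pk f.
Proof. by case: _ / eX; case: _ / eY. Qed.

Lemma cast_homE (X Y : C) (eX : X = X) (eY : Y = Y) (f : hom X Y) :
  cast_hom eX eY f = f.
Proof. by rewrite (proof_irrelevance _ eX erefl) (proof_irrelevance _ eY erefl). Qed.

Lemma pk_inj (X Y : C) (f g : hom X Y) : pk f = pk g -> f = g.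
Proof.
case=> E; apply: (inj_pair2 C (fun Y => hom X Y)).
by apply: (inj_pair2 C (fun X => {Y : C & hom X Y})).
Qed.

Lemma eqmP (X X' Y Y' : C) (eX : obj_eq X X') (eY : obj_eq Y Y')
    (f : hom X Y) (g : hom X' Y') : f ≗ g <-> pk f = pk g.
Proof.
rewrite /eqm; split=> [<-|E]; first by rewrite pk_cast.
by apply: pk_inj; rewrite pk_cast.
Qed.

Lemma acompE (X Y Z : C) (g : hom Y Z) (f : hom X Y) : acomp (pk g) (pk f) = pk (comp g f).
Proof.
rewrite /acomp /=; case: excluded_middle_informative => [/= e|[]] //.
by rewrite cast_homE.
Qed.

Lemma pk_scomp (X Y Y' Z : C) (e : obj_eq Y Y') (g : hom Y' Z) (f : hom X Y) :
  pk (g ∘ f) = acomp (pk g) (pk f).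
Proof. by rewrite /scomp -acompE pk_cast. Qed.

Lemma pk_comp (X Y Z : C) (g : hom Y Z) (f : hom X Y) : pk (comp g f) = acomp (pk g) (pk f).
Proof. by rewrite acompE. Qed.

Lemma pk_tens (X X' Y Y' : C) (f : hom X X') (g : hom Y Y') :
  pk (f ⊠ g) = atens (pk f) (pk g).
Proof. by []. Qed.

Lemma pk_id_tens (X Y : C) : pk (idm (X ⊗ Y)) = atens (pk (idm X)) (pk (idm Y)).
Proof. by rewrite -pk_tens tensm_id. Qed.

Lemma acompA a b c : acomp a (acomp b c) = acomp (acomp a b) c.
Proof.
case: a => [[Z T h]|] //; case: b => [[Y Z' g]|] //; case: c => [[X Y' f]|] //=.
- case: excluded_middle_informative => [e|n]; case: excluded_middle_informative => [e'|n'] //=.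
  + case: excluded_middle_informative => // e2; case: excluded_middle_informative => // e3.
    subst Z' Y'; by rewrite !cast_homE compA.
  + by case: excluded_middle_informative.
  + by case: excluded_middle_informative.
- by case: excluded_middle_informative.
Qed.

Lemma atensA a b c : atens a (atens b c) = atens (atens a b) c.
Proof.
case: a b c => [[X X' f]|] [[Y Y' g]|] [[Z Z' h]|] //=.
by rewrite -[RHS]/(pk _) -tensmA pk_cast.
Qed.

Lemma aten1m a : atens (pk (idm K)) a = a.
Proof. by case: a => [[X X' f]|] //=; rewrite -[RHS]/(pk f) -{2}[f]tens1m pk_cast. Qed.

Lemma atenm1 a : atens a (pk (idm K)) = a.
Proof. by case: a => [[X X' f]|] //=; rewrite -[RHS]/(pk f) -{2}[f]tensm1 pk_cast. Qed.

Definition to_tgt (a : option arrow) (Y : C) : Prop := exists X, typed a X Y.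
Definition from_src (a : option arrow) (X : C) : Prop := exists Y, typed a X Y.
Definition composable (a b : option arrow) : Prop :=
  exists Y, from_src a Y /\ to_tgt b Y.

Lemma acomp1m a Y : to_tgt a Y -> acomp (pk (idm Y)) a = a.
Proof. by case=> X [f ->]; rewrite acompE comp1m. Qed.

Lemma acompm1 a X : from_src a X -> acomp a (pk (idm X)) = a.
Proof. by case=> Y [f ->]; rewrite acompE compm1. Qed.

Lemma interchange a b c d : composable a b -> composable c d ->
  acomp (atens a c) (atens b d) = atens (acomp a b) (acomp c d).
Proof.
case=> Y [] [Z] [f ->] [X] [g ->] [Y'] [] [Z'] [h ->] [X'] [k ->].
by rewrite -!pk_tens !acompE -pk_tens tensm_comp.
Qed.

Lemma abraid_nat a b X X' Y Y' : typed a X X' -> typed b Y Y' ->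
  acomp (pk (braid X' Y')) (atens a b) = acomp (atens b a) (pk (braid X Y)).
Proof. by case=> f -> [g ->]; rewrite -!pk_tens -!pk_scomp braid_nat. Qed.

Lemma typed_pk X Y (f : hom X Y) : typed (pk f) X Y.
Proof. by exists f. Qed.

Lemma typed_tens a b X X' Y Y' : typed a X X' -> typed b Y Y' ->
  typed (atens a b) (X ⊗ Y) (X' ⊗ Y').
Proof. by case=> f -> [g ->]; exists (f ⊠ g). Qed.

Lemma typed_comp a b X Y Y' Z : typed a Y' Z -> typed b X Y -> Y = Y' ->
  typed (acomp a b) X Z.
Proof. by move=> [f ->] [g ->] E; subst Y'; exists (comp f g); rewrite acompE. Qed.

Lemma typed_eq a X Y X' Y' : typed a X Y -> X = X' -> Y = Y' -> typed a X' Y'.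
Proof. by move=> H <- <-. Qed.

Lemma acompAE a b c x : acomp a b = c -> acomp (acomp x a) b = acomp x c.
Proof. by move=> <-; rewrite acompA. Qed.

Lemma interchangeA x a b c d : composable a b -> composable c d ->
  acomp (acomp x (atens a c)) (atens b d) = acomp x (atens (acomp a b) (acomp c d)).
Proof. by move=> ab cd; rewrite -acompA (interchange ab cd). Qed.

End Arrows.

Ltac objeq :=
  solve [ exact (eq_refl _)
        | repeat first [rewrite tens1o | rewrite tenso1 | rewrite tensA]; exact (eq_refl _) ].
Ltac ty_inf :=
  first [ apply: typed_pk
        | eapply typed_tens; [ty_inf | ty_inf]
        | eapply typed_comp; [ty_inf | ty_inf | objeq] ].
Ltac ty1 := eapply typed_eq; [ty_inf | objeq | objeq].
Ltac ty :=
  match goal with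
  | |- typed _ _ _ => ty1
  | |- to_tgt _ _ => eexists; ty1
  | |- from_src _ _ => eexists; ty1
  | |- composable _ _ => eexists; split; [eexists; ty1 | eexists; ty1]
  end.

Local Notation "⟦ f ⟧" := (pk f) (at level 0, f at level 99).
Local Notation "a • b" := (acomp a b) (at level 40, left associativity).
Local Notation "a ⊙ b" := (atens a b) (at level 39, right associativity).

Section InducedBrace.
Variables (C : strict_braided) (A H : hopf_algebra C).
Variables (phiH : module_algebra A H) (pi : inv_cocycle phiH).

Local Notation p := (pk (iso_hom pi)).
Local Notation q := (pk (iso_inv pi)).
Local Notation iA := (pk (idm (carrier A))).
Local Notation iH := (pk (idm (carrier H))).
Local Notation iK := (pk (idm (@unit_obj C))).

Definition mu_pi : hom (H ⊗ H) H := pi ∘ μ[A] ∘ (iso_inv pi ⊠ iso_inv pi).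
Definition lam_pi : hom H H := pi ∘ λ[A] ∘ iso_inv pi.

Lemma qp : q • p = iA. Proof. by rewrite acompE iso_homK. Qed.
Lemma pq : p • q = iH. Proof. by rewrite acompE iso_invK. Qed.

Local Notation mA := ⟦μ[A]⟧.
Local Notation mH := ⟦μ[H]⟧.
Local Notation dA := ⟦δ[A]⟧.
Local Notation dH := ⟦δ[H]⟧.
Local Notation uA := ⟦η[A]⟧.
Local Notation uH := ⟦η[H]⟧.
Local Notation eA := ⟦ε[A]⟧.
Local Notation eH := ⟦ε[H]⟧.
Local Notation lA := ⟦λ[A]⟧.
Local Notation lH := ⟦λ[H]⟧.
Local Notation f := ⟦ma_act phiH⟧.
Local Notation mP := ⟦mu_pi⟧.
Local Notation cHH := ⟦iso_hom (braid (carrier H) (carrier H))⟧.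
Local Notation hf := (f • (q ⊙ iH)).

Lemma pk_mu_pi : mP = p • mA • (q ⊙ q).
Proof. by rewrite /mu_pi !pk_scomp !pk_tens. Qed.

Lemma pk_coc : p • mA = mH • (p ⊙ f) • (dA ⊙ p).
Proof. by rewrite -!pk_tens -!pk_scomp ic_mul. Qed.

Lemma delta_pi : dH • p = (p ⊙ p) • dA.
Proof. by rewrite -!pk_tens -!pk_scomp ic_delta. Qed.

Lemma delta_pi_inv : dA • q = (q ⊙ q) • dH.
Proof.
have -> : dH = (p ⊙ p) • dA • q by rewrite -delta_pi -acompA pq acompm1 //; ty.
rewrite !acompA interchange; try ty.
rewrite qp -pk_id_tens acomp1m //; ty.
Qed.

Lemma eps_pi_inv : eA • q = eH.
Proof.
have -> : eA = eH • p by rewrite -pk_scomp ic_eps.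
by rewrite -acompA pq acompm1 //; ty.
Qed.

Lemma mu1H : mH • (uH ⊙ iH) = iH.
Proof. by rewrite -pk_tens -pk_scomp; apply/eqmP; apply: mu1m. Qed.

Lemma mum1H : mH • (iH ⊙ uH) = iH.
Proof. by rewrite -pk_tens -pk_scomp; apply/eqmP; apply: mum1. Qed.

Lemma muAH : mH • (iH ⊙ mH) = mH • (mH ⊙ iH).
Proof. by rewrite -!pk_tens -!pk_scomp; apply/eqmP; apply: muA. Qed.

Lemma mu1A : mA • (uA ⊙ iA) = iA.
Proof. by rewrite -pk_tens -pk_scomp; apply/eqmP; apply: mu1m. Qed.

Lemma mum1A : mA • (iA ⊙ uA) = iA.
Proof. by rewrite -pk_tens -pk_scomp; apply/eqmP; apply: mum1. Qed.

Lemma muAA : mA • (iA ⊙ mA) = mA • (mA ⊙ iA).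
Proof. by rewrite -!pk_tens -!pk_scomp; apply/eqmP; apply: muA. Qed.

Lemma delta1H : (eH ⊙ iH) • dH = iH.
Proof. by rewrite -!pk_tens -!pk_scomp; apply/eqmP; apply: delta1m. Qed.

Lemma deltaAH : (iH ⊙ dH) • dH = (dH ⊙ iH) • dH.
Proof. by rewrite -!pk_tens -!pk_scomp; apply/eqmP; apply: deltaA. Qed.

Lemma delta_etaA : dA • uA = uA ⊙ uA.
Proof. by rewrite -!pk_tens -!pk_scomp; apply/eqmP; apply: delta_eta. Qed.

Lemma delta_muA : dA • mA = (mA ⊙ mA) • (iA ⊙ ⟦braid A A⟧ ⊙ iA) • (dA ⊙ dA).
Proof. by rewrite -!pk_tens -!pk_scomp; congr pk; apply: delta_mu. Qed.

Lemma eps_muA : eA • mA = eA ⊙ eA.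
Proof. by rewrite -!pk_tens -!pk_scomp; apply/eqmP; apply: eps_mu. Qed.

Lemma antipodelA : mA • (lA ⊙ iA) • dA = uA • eA.
Proof. by rewrite -!pk_tens -!pk_scomp; congr pk; apply: antipodel. Qed.

Lemma antipoderA : mA • (iA ⊙ lA) • dA = uA • eA.
Proof. by rewrite -!pk_tens -!pk_scomp; congr pk; apply: antipoder. Qed.

Lemma antipodelH : mH • (lH ⊙ iH) • dH = uH • eH.
Proof. by rewrite -!pk_tens -!pk_scomp; congr pk; apply: antipodel. Qed.

Lemma act1 : f • (uA ⊙ iH) = iH.
Proof. by rewrite -!pk_tens -!pk_scomp; apply/eqmP; case: (ma_lmodule phiH). Qed.

Lemma act_mul : f • (iA ⊙ mH) =
  mH • (f ⊙ f) • (iA ⊙ ⟦braid A H⟧ ⊙ iH) • (dA ⊙ iH ⊙ iH).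
Proof. by rewrite -!pk_tens -!pk_scomp; apply/eqmP; apply: ma_mul. Qed.

Lemma eta_pi : p • uA = uH.
Proof.
have E : mH • ((p • uA) ⊙ iH) = iH.
  transitivity (p • mA • (uA ⊙ q)).
    rewrite pk_coc -(acompA (_ • _)) interchange; try ty.
    rewrite delta_etaA pq -atensA -acompA interchange; try ty.
    by rewrite act1.
  have -> : uA ⊙ q = (uA ⊙ iA) • q.
    rewrite -{2}[q]aten1m interchange; try ty.
    by rewrite acompm1 ?acomp1m //; ty.
  rewrite !acompA -(acompA p) mu1A acompm1 ?pq //; ty.
rewrite -[RHS](@acomp1m _ _ (carrier H)); last ty.
rewrite -{1}E -acompA -{1}[uH]aten1m interchange; try ty.
rewrite acompm1; last ty.
rewrite acomp1m; last ty.
have -> : (p • uA) ⊙ uH = (iH ⊙ uH) • (p • uA).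
  rewrite -{2}[p • uA]atenm1 interchange; try ty.
  by rewrite acompm1 ?acomp1m //; ty.
rewrite !acompA mum1H acomp1m //; ty.
Qed.

Lemma mu_piE : mP = mH • (iH ⊙ hf) • (dH ⊙ iH).
Proof.
rewrite pk_mu_pi pk_coc -acompA interchange; try ty.
rewrite delta_pi_inv pq.
have -> : ((q ⊙ q) • dH) ⊙ iH = (q ⊙ q ⊙ iH) • (dH ⊙ iH).
  by rewrite atensA interchange ?acomp1m //; ty.
rewrite acompA -(acompA mH) interchange; try ty.
by rewrite pq.
Qed.

Lemma gamma_piE : mH • (lH ⊙ mP) • (dH ⊙ iH) = hf.
Proof.
have -> : lH ⊙ mP = (iH ⊙ mH) • (lH ⊙ iH ⊙ hf) • (iH ⊙ dH ⊙ iH).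
  rewrite mu_piE !interchange; try ty.
  by rewrite acomp1m ?acompm1 //; ty.
rewrite !acompA muAH -acompA.
have -> : (iH ⊙ dH ⊙ iH) • (dH ⊙ iH) = (dH ⊙ iH ⊙ iH) • (dH ⊙ iH).
  rewrite !atensA interchange; try ty.
  rewrite deltaAH -atensA -pk_id_tens -interchange; try ty.
  by rewrite pk_id_tens -atensA.
rewrite acompA -(acompA mH) atensA interchange; try ty.
rewrite acomp1m; last ty.
rewrite -(acompA mH) interchange; try ty.
rewrite antipodelH.
have -> : (uH • eH) ⊙ (hf • (iH ⊙ iH)) = (uH ⊙ iH) • (eH ⊙ hf).
  rewrite interchange; try ty.
  by rewrite -pk_id_tens acomp1m ?acompm1 //; ty.
rewrite !acompA mu1H acomp1m; last ty.
have -> : eH ⊙ hf = hf • (eH ⊙ iH ⊙ iH).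
  rewrite -[in RHS](aten1m hf) -pk_id_tens interchange; try ty.
  by rewrite acomp1m ?acompm1 //; ty.
rewrite -acompA atensA interchange; try ty.
rewrite delta1H acompm1; last ty.
by rewrite -pk_id_tens acompm1 //; ty.
Qed.

Lemma hf_mul : hf • (iH ⊙ mH) = mH • (hf ⊙ hf) • (iH ⊙ cHH ⊙ iH) • (dH ⊙ iH ⊙ iH).
Proof.
have -> : hf • (iH ⊙ mH) = f • (iA ⊙ mH) • (q ⊙ iH ⊙ iH).
  rewrite -!acompA !interchange; try ty.
  by rewrite -pk_id_tens !acomp1m ?acompm1 //; ty.
rewrite act_mul -acompA interchange; try ty.
rewrite delta_pi_inv -pk_id_tens.
rewrite acomp1m; last ty.
have -> : ((q ⊙ q) • dH) ⊙ ⟦idm (H ⊗ H)⟧ = (q ⊙ q ⊙ iH ⊙ iH) • (dH ⊙ iH ⊙ iH).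
  rewrite -pk_id_tens atensA interchange; try ty.
  by rewrite acomp1m //; ty.
rewrite acompA -(acompA (mH • _)).
have -> : (iA ⊙ ⟦braid A H⟧ ⊙ iH) • (q ⊙ q ⊙ iH ⊙ iH) =
          (q ⊙ iH ⊙ q ⊙ iH) • (iH ⊙ cHH ⊙ iH).
  rewrite (atensA q iH iH) interchange; try ty.
  rewrite !(atensA _ _ iH) !interchange; try ty.
  rewrite (@abraid_nat _ q iH H A H H); try ty.
  by rewrite acomp1m ?acompm1 ?atensA //; ty.
rewrite pk_id_tens !acompA -!(acompA mH) (atensA q iH) interchange; try ty.
by [].
Qed.

Lemma brace_piE :
  mP • (iH ⊙ mH) = mH • (mP ⊙ hf) • (iH ⊙ cHH ⊙ iH) • (dH ⊙ iH ⊙ iH).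
Proof.
rewrite {1}mu_piE -acompA interchange; try ty.
have -> : (dH • iH) ⊙ (iH • mH) = (iH ⊙ iH ⊙ mH) • (dH ⊙ iH ⊙ iH).
  rewrite atensA interchange; try ty.
  rewrite -!pk_id_tens.
  by rewrite !acomp1m ?acompm1 //; ty.
rewrite acompA -(acompA mH) interchange; try ty.
rewrite hf_mul acompm1; last ty.
have -> : iH ⊙ (mH • (hf ⊙ hf) • (iH ⊙ cHH ⊙ iH) • (dH ⊙ iH ⊙ iH)) =
  (iH ⊙ mH) • (iH ⊙ hf ⊙ hf) • (iH ⊙ iH ⊙ cHH ⊙ iH) • (iH ⊙ dH ⊙ iH ⊙ iH).
  rewrite !interchange; try ty.
  by rewrite !acomp1m //; ty.
rewrite !acompA muAH -!acompA.
have -> : (iH ⊙ dH ⊙ iH ⊙ iH) • (dH ⊙ iH ⊙ iH) =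
          (dH ⊙ iH ⊙ iH ⊙ iH) • (dH ⊙ iH ⊙ iH).
  by rewrite !atensA !interchange ?deltaAH //; ty.
have -> : (iH ⊙ iH ⊙ cHH ⊙ iH) • ((dH ⊙ iH ⊙ iH ⊙ iH) • (dH ⊙ iH ⊙ iH)) =
  (dH ⊙ iH ⊙ iH ⊙ iH) • ((iH ⊙ cHH ⊙ iH) • (dH ⊙ iH ⊙ iH)).
  rewrite !acompA; congr (_ • _).
  have -> : iH ⊙ iH ⊙ cHH ⊙ iH = (iH ⊙ iH) ⊙ (cHH ⊙ iH) by rewrite atensA.
  rewrite -!pk_id_tens !interchange; try ty.
  by rewrite !acomp1m ?acompm1 //; ty.
rewrite !acompA mu_piE; congr (_ • _ • _).
rewrite -!acompA; congr (_ • _).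
rewrite (atensA iH hf hf) (atensA dH iH).
set X := iH ⊙ hf; set Y := dH ⊙ iH; rewrite interchange; try ty.
rewrite [in LHS]interchange; try ty.
rewrite acompA acomp1m; last ty.
by rewrite -pk_id_tens acompm1 //; ty.
Qed.

Lemma eta_pi_inv : q • uH = uA.
Proof. by rewrite -eta_pi acompA qp acomp1m //; ty. Qed.

Lemma pk_lam_pi : ⟦lam_pi⟧ = p • lA • q.
Proof. by rewrite /lam_pi !pk_scomp. Qed.

Lemma mu_pi1m : mu_pi ∘ (η[H] ⊠ idm H) ≗ idm H.
Proof.
apply/eqmP; rewrite !pk_scomp !pk_tens ?pk_mu_pi ?pk_lam_pi -acompA interchange; try ty.
rewrite eta_pi_inv acompm1; last ty.
have -> : uA ⊙ q = (uA ⊙ iA) • q.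
  rewrite -{2}[q]aten1m interchange; try ty.
  by rewrite acompm1 ?acomp1m //; ty.
rewrite !acompA -(acompA p) mu1A acompm1 ?pq //; ty.
Qed.

Lemma mu_pim1 : mu_pi ∘ (idm H ⊠ η[H]) ≗ idm H.
Proof.
apply/eqmP; rewrite !pk_scomp !pk_tens ?pk_mu_pi ?pk_lam_pi -acompA interchange; try ty.
rewrite eta_pi_inv acompm1; last ty.
have -> : q ⊙ uA = (iA ⊙ uA) • q.
  rewrite -{2}[q]atenm1 interchange; try ty.
  by rewrite acompm1 ?acomp1m //; ty.
rewrite !acompA -(acompA p) mum1A acompm1 ?pq //; ty.
Qed.

Lemma mu_piA : mu_pi ∘ (idm H ⊠ mu_pi) ≗ mu_pi ∘ (mu_pi ⊠ idm H).
Proof.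
apply/eqmP; rewrite !pk_scomp !pk_tens ?pk_mu_pi ?pk_lam_pi.
rewrite -!(acompA (p • _)) !interchange; try ty.
rewrite !acompm1; try ty.
rewrite !acompA qp acomp1m; last ty.
have -> : q ⊙ (mA • (q ⊙ q)) = (iA ⊙ mA) • (q ⊙ q ⊙ q).
  by rewrite interchange ?acomp1m //; ty.
have -> : (mA • (q ⊙ q)) ⊙ q = (mA ⊙ iA) • (q ⊙ q ⊙ q).
  by rewrite atensA interchange ?acomp1m //; ty.
by rewrite !acompA -!(acompA p) muAA.
Qed.

Lemma eps_mu_pi : ε[H] ∘ mu_pi ≗ ε[H] ⊠ ε[H].
Proof.
apply/eqmP; rewrite !pk_scomp !pk_tens ?pk_mu_pi ?pk_lam_pi !acompA.
have -> : eH • p = eA by rewrite -pk_scomp ic_eps.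
by rewrite eps_muA interchange ?eps_pi_inv //; ty.
Qed.

Lemma delta_mu_pi : δ[H] ∘ mu_pi =
  (mu_pi ⊠ mu_pi) ∘ (idm H ⊠ braid H H ⊠ idm H) ∘ (δ[H] ⊠ δ[H]).
Proof.
apply: pk_inj; rewrite !pk_scomp !pk_tens ?pk_mu_pi ?pk_lam_pi !acompA.
rewrite delta_pi -(acompA _ dA) delta_muA -!acompA interchange; try ty.
rewrite delta_pi_inv.
have -> : ((q ⊙ q) • dH) ⊙ ((q ⊙ q) • dH) = (q ⊙ q ⊙ q ⊙ q) • (dH ⊙ dH).
  by rewrite (atensA q q (q ⊙ q)) interchange //; ty.
have E : (iA ⊙ ⟦braid A A⟧ ⊙ iA) • (q ⊙ q ⊙ q ⊙ q) =
         (q ⊙ q ⊙ q ⊙ q) • (iH ⊙ cHH ⊙ iH).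
  rewrite (atensA q q q) !interchange; try ty.
  by rewrite (@abraid_nat _ q q H A H A) ?acomp1m ?acompm1 //; ty.
rewrite (acompA (iA ⊙ _)) E !acompA interchange; try ty.
by rewrite (atensA q q (q ⊙ q)) interchange //; ty.
Qed.

Lemma antipodel_pi : mu_pi ∘ (lam_pi ⊠ idm H) ∘ δ[H] = η[H] ∘ ε[H].
Proof.
apply: pk_inj; rewrite !pk_scomp !pk_tens ?pk_mu_pi ?pk_lam_pi.
rewrite -(acompA (p • mA)) interchange; try ty.
rewrite !acompA qp acomp1m; last ty.
have -> : (lA • q) ⊙ (q • iH) = (lA ⊙ iA) • (q ⊙ q).
  by rewrite interchange ?acomp1m ?acompm1 //; ty.
rewrite -!acompA -delta_pi_inv !acompA -!(acompA p) antipodelA.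
by rewrite -(acompA uA) eps_pi_inv acompA eta_pi.
Qed.

Lemma antipoder_pi : mu_pi ∘ (idm H ⊠ lam_pi) ∘ δ[H] = η[H] ∘ ε[H].
Proof.
apply: pk_inj; rewrite !pk_scomp !pk_tens ?pk_mu_pi ?pk_lam_pi.
rewrite -(acompA (p • mA)) interchange; try ty.
rewrite !acompA qp acomp1m; last ty.
have -> : (q • iH) ⊙ (lA • q) = (iA ⊙ lA) • (q ⊙ q).
  by rewrite interchange ?acomp1m ?acompm1 //; ty.
rewrite -!acompA -delta_pi_inv !acompA -!(acompA p) antipoderA.
by rewrite -(acompA uA) eps_pi_inv acompA eta_pi.
Qed.

Definition alg_pi : algebra_on (carrier H) := AlgebraOn mu_pi1m mu_pim1 mu_piA.

Definition hopf_pi : hopf_on (coalg H) :=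
  @HopfOn C H (coalg H) alg_pi lam_pi (eps_eta (hopf H)) eps_mu_pi
    (delta_eta (hopf H)) delta_mu_pi antipodel_pi antipoder_pi.

Lemma hopf_pi_brace : hopf_brace_law (hopf H) hopf_pi.
Proof.
apply: pk_inj; rewrite /gamma_act !pk_scomp !pk_tens !pk_scomp !pk_tens.
rewrite -[mu (hopf H)]/(μof H) -[mu hopf_pi]/mu_pi -[delta (coalg H)]/(δof H).
rewrite -[antipode (hopf H)]/(λof H).
by rewrite -!pk_mu_pi gamma_piE brace_piE.
Qed.

Definition brace_pi : hopf_brace C := HopfBrace hopf_pi_brace.
End InducedBrace.

(* Main.v *)
Require Import Defs.
From mathcomp Require Import ssreflect.

(** Let [p] be the cocycle, [q] its inverse, and write [h1, h2] for the two legs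
of the comultiplication of [h].

To a module [(M, N, phiM, varphiM, phiN, gamma)] over the cocycle corresponds the
brace module [M] whose first action is [varphiM] and whose second action is [phiN]
carried from [(A, N)] to [(H, M)] along [q] and [gamma].  Conversely, a brace
module [(M, psi1, psi2)] gives the cocycle module with [N = M], [gamma = id],
[phiN = psi2] pulled back along [p], and [phiM = Gamma] pulled back along [p],
where [Gamma (h, m) = psi1 (antipode h1, psi2 (h2, m))].

The link between the two sides is that [Gamma] is the only map with
[psi2 (h, m) = psi1 (h1, Gamma (h2, m))]: the operation
[s |-> psi1 (h1, s (h2, m))] is inverted by the antipode ([conv_cancel]).  For a
cocycle module, the equation on [gamma] says that [phiM (q h, m)] has this
property, so it is [Gamma] ([cm_gammaE]).  Hence the two constructions are inverse
to each other, up to replacing [N] by the isomorphic object [M].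

The same cancellation proves that the constructions land in the right categories.
- Since [mu_pi (h, k) = mu (h1, hf (h2, k))] with [hf (h, k) = phiH (q h, k)], the
  compatibility of a brace module is, after cancelling [h1], the rule
  [Gamma (h, psi1 (k, m)) = psi1 (hf (h1, k), Gamma (h2, m))]
  ([brace_compat_gamma]).  Along [p] this is the compatibility of [phiM] with
  [varphiM] ([action_compat]).
- [Gamma] is an action of [mu_pi] ([gammaA]): expanding [psi2 (h, psi2 (k, m))]
  in two ways shows that [Gamma (h, Gamma (k, m))] and [Gamma (mu_pi (h, k), m)]
  agree after acting by [mu_pi (h1, k1)], and this factor can be cancelled because
  [mu_pi] is a coalgebra map from the braided tensor coalgebra on [H] and [H]
  to [H].  Coassociativity of that coalgebra is where the hexagon
  identities enter.

All computations are made on packed arrows, where composition and tensor are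
strictly associative. *)

Set Implicit Arguments.
Unset Strict Implicit.
Unset Printing Implicit Defensive.

Local Open Scope cat_scope.

Local Notation "⟦ f ⟧" := (pk f) (at level 0, f at level 99).
Local Notation "a • b" := (acomp a b) (at level 40, left associativity).
Local Notation "a ⊙ b" := (atens a b) (at level 39, right associativity).

(** * Rewriting with packed arrows *)

(* Dispatching on the head symbol keeps [typed_pk] from unfolding a tensor product
   of two packed arrows into a single one, whose source and target would then be
   unreadable; the last case handles abstract arrows with a typing hypothesis. *)
Ltac ty_inf ::=
  lazymatch goal with
  | |- typed (atens _ _) _ _ => eapply typed_tens; [ty_inf | ty_inf]
  | |- typed (acomp _ _) _ _ => eapply typed_comp; [ty_inf | ty_inf | objeq]
  | |- typed (pk _) _ _ => apply: typed_pk
  | |- _ => eassumption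
  end.

Ltac inter := rewrite interchange; [|ty|ty].
Ltac idc := repeat
  match goal with
  | |- context [acomp (pk (idm ?X)) ?a] => rewrite (@acomp1m _ a X); [|ty]
  | |- context [acomp ?a (pk (idm ?X))] => rewrite (@acompm1 _ a X); [|ty]
  end.
(* Fuses composites of tensor products factor by factor.  Only the splittings that
   typecheck are tried, so the bracketing of the tensor products chosen beforehand
   decides which strands are fused. *)
Ltac par := repeat first [progress idc |
  match goal with
  | |- context [acomp (atens ?a ?c) (atens ?b ?d)] =>
      rewrite (@interchange _ a b c d); [|ty|ty]
  | |- context [acomp (acomp ?x (atens ?a ?c)) (atens ?b ?d)] =>
      rewrite (@interchangeA _ x a b c d); [|ty|ty]
  end].

(** * Cancelling a convolution-invertible factor *)

Section ConvolutionCancellation.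
Variables (C : strict_braided) (B : C) (algB : algebra_on B).
Variables (M : C) (act : hom (B ⊗ M) M) (actP : is_lmodule algB act).
Variables (D X : C) (d e x y s : option (arrow C)).
Hypotheses (dT : typed d D (D ⊗ D)) (eT : typed e D K).
Hypotheses (xT : typed x D B) (yT : typed y D B) (sT : typed s (D ⊗ X) M).

Local Notation iB := ⟦idm B⟧.
Local Notation iD := ⟦idm D⟧.
Local Notation iX := ⟦idm X⟧.
Local Notation iM := ⟦idm M⟧.

Lemma lmodule1 : ⟦act⟧ • (⟦eta algB⟧ ⊙ iM) = iM.
Proof. by rewrite -pk_tens -pk_scomp; apply/eqmP; case: actP. Qed.

Lemma lmoduleA : ⟦act⟧ • (iB ⊙ ⟦act⟧) = ⟦act⟧ • (⟦mu algB⟧ ⊙ iM).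
Proof. by rewrite -!pk_tens -!pk_scomp; apply/eqmP; case: actP. Qed.

(** The module law brings [x d1] and [y d2] together in
[act (x d1, act (y d2, s (d3, v)))]; there they convolve to the unit.
The coalgebra [D] is given by packed arrows so that it can be a tensor product,
whose comultiplication has its target bracketed differently. *)
Lemma conv_cancel :
  (iD ⊙ d) • d = (d ⊙ iD) • d -> (e ⊙ iD) • d = iD ->
  ⟦mu algB⟧ • (x ⊙ y) • d = ⟦eta algB⟧ • e ->
  ⟦act⟧ • (x ⊙ (⟦act⟧ • (y ⊙ s) • (d ⊙ iX))) • (d ⊙ iX) = s.
Proof.
move=> dA d1 xy.
have -> : x ⊙ (⟦act⟧ • (y ⊙ s) • (d ⊙ iX)) =
    (iB ⊙ ⟦act⟧) • (x ⊙ y ⊙ s) • (iD ⊙ d ⊙ iX).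
  by do 2 inter; idc.
rewrite !acompA lmoduleA -!acompA.
have -> : (iD ⊙ d ⊙ iX) • (d ⊙ iX) = (d ⊙ iD ⊙ iX) • (d ⊙ iX).
  rewrite !atensA; do 2 inter; by rewrite dA.
rewrite (acompA (x ⊙ _)) (atensA x).
inter; rewrite (acompA (⟦mu _⟧ ⊙ _)); inter.
rewrite (acompA ⟦mu _⟧) xy -pk_id_tens; idc.
have -> : (⟦eta algB⟧ • e) ⊙ s = (⟦eta algB⟧ ⊙ iM) • s • (e ⊙ iD ⊙ iX).
  rewrite -acompA -{2}[s]aten1m; inter; idc.
  by inter; rewrite -pk_id_tens; idc.
rewrite !acompA lmodule1; idc.
by rewrite -acompA atensA; inter; rewrite d1; idc; rewrite -pk_id_tens; idc.
Qed.

End ConvolutionCancellation.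

Lemma pk_delta1 (C : strict_braided) (X : C) (coX : coalgebra_on X) :
  (⟦eps coX⟧ ⊙ ⟦idm X⟧) • ⟦delta coX⟧ = ⟦idm X⟧.
Proof. by rewrite -!pk_tens -!pk_scomp; apply/eqmP; apply: delta1m. Qed.

Lemma pk_deltaA (C : strict_braided) (X : C) (coX : coalgebra_on X) :
  (⟦idm X⟧ ⊙ ⟦delta coX⟧) • ⟦delta coX⟧ = (⟦delta coX⟧ ⊙ ⟦idm X⟧) • ⟦delta coX⟧.
Proof. by rewrite -!pk_tens -!pk_scomp; apply/eqmP; apply: deltaA. Qed.

(** * The braided tensor product of two coalgebras *)

Section TensorCoalgebra.
Variables (C : strict_braided) (X Y : C) (coX : coalgebra_on X) (coY : coalgebra_on Y).

Local Notation iX := ⟦idm X⟧.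
Local Notation iY := ⟦idm Y⟧.
Local Notation iXY := ⟦idm (X ⊗ Y)⟧.
Local Notation dX := ⟦delta coX⟧.
Local Notation dY := ⟦delta coY⟧.
Local Notation eX := ⟦eps coX⟧.
Local Notation eY := ⟦eps coY⟧.
Local Notation c := ⟦iso_hom (braid X Y)⟧.

(** The hexagon identity at the unit object makes this braiding idempotent, and an
invertible idempotent is the identity. *)
Lemma braid_unitr (Z : C) : ⟦iso_hom (braid Z K)⟧ = ⟦idm Z⟧.
Proof.
have swapK W : W = K -> ⟦iso_hom (braid Z W)⟧ = ⟦iso_hom (braid Z K)⟧ by move=> ->.
have /eqmP := braid_tensr Z K K.
rewrite pk_scomp !pk_tens aten1m atenm1 (swapK _ (tens1o K)) => idem.
have inv : ⟦iso_inv (braid Z K)⟧ • ⟦iso_hom (braid Z K)⟧ = ⟦idm Z⟧.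
  by rewrite acompE iso_homK pk_id_tens atenm1.
by rewrite -inv {2}idem acompA inv; idc.
Qed.

Definition tensor_delta := (iX ⊙ c ⊙ iY) • (dX ⊙ dY).
Definition tensor_eps := eX ⊙ eY.

Lemma tensor_deltaT : typed tensor_delta (X ⊗ Y) ((X ⊗ Y) ⊗ (X ⊗ Y)).
Proof. rewrite /tensor_delta; ty. Qed.

Lemma tensor_epsT : typed tensor_eps (X ⊗ Y) K.
Proof. rewrite /tensor_eps; ty. Qed.

Lemma tensor_delta1 : (tensor_eps ⊙ iXY) • tensor_delta = iXY.
Proof.
rewrite /tensor_eps /tensor_delta pk_id_tens.
have ceps : (eY ⊙ iX) • c = iX ⊙ eY.
  have <- := @abraid_nat _ iX eY X X Y K; [|ty|ty].
  by rewrite braid_unitr; idc.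
rewrite acompA.
have -> : ((eX ⊙ eY) ⊙ iX ⊙ iY) • (iX ⊙ c ⊙ iY) = (eX ⊙ iX) ⊙ eY ⊙ iY.
  rewrite -atensA (atensA eY); do 2 inter.
  by rewrite ceps; idc; rewrite -!atensA.
by inter; rewrite !pk_delta1.
Qed.

(** Both sides reduce to the iterated comultiplications of [X] and [Y] followed by the
same shuffle of six strands; naturality and the hexagon identities move the second
comultiplication past the braiding ([braidX], [braidY]). *)
Lemma tensor_deltaA :
  (iXY ⊙ tensor_delta) • tensor_delta = (tensor_delta ⊙ iXY) • tensor_delta.
Proof.
have braidX : (iY ⊙ dX) • c = (c ⊙ iX) • (iX ⊙ c) • (dX ⊙ iY).
  have <- := @abraid_nat _ dX iY X (X ⊗ X) Y Y; [|ty|ty].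
  have /eqmP -> := braid_tensl X X Y.
  by rewrite pk_scomp !pk_tens.
have braidY : (dY ⊙ iX) • c = (iY ⊙ c) • (c ⊙ iY) • (iX ⊙ dY).
  have <- := @abraid_nat _ iX dY X X Y (Y ⊗ Y); [|ty|ty].
  have /eqmP -> := braid_tensr X Y Y.
  by rewrite pk_scomp !pk_tens.
rewrite /tensor_delta pk_id_tens.
have -> : (iX ⊙ iY) ⊙ ((iX ⊙ c ⊙ iY) • (dX ⊙ dY)) =
    (iX ⊙ iY ⊙ iX ⊙ c ⊙ iY) • (iX ⊙ (iY ⊙ dX) ⊙ dY).
  by rewrite -!atensA; par.
have -> : ((iX ⊙ c ⊙ iY) • (dX ⊙ dY)) ⊙ iX ⊙ iY =
    (iX ⊙ c ⊙ iY ⊙ iX ⊙ iY) • (dX ⊙ (dY ⊙ iX) ⊙ iY).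
  rewrite -(atensA dY) (atensA dX).
  have -> : iX ⊙ c ⊙ iY ⊙ iX ⊙ iY = (iX ⊙ c ⊙ iY) ⊙ iX ⊙ iY by rewrite -!atensA.
  by par.
rewrite !acompA -!(acompA _ _ (iX ⊙ c ⊙ iY)).
rewrite [in LHS]interchange; [|ty|ty]; rewrite [in RHS]interchange; [|ty|ty].
rewrite [(iY ⊙ dX) ⊙ dY • _]interchange; [|ty|ty].
rewrite [(dY ⊙ iX) ⊙ iY • _]interchange; [|ty|ty].
rewrite braidX braidY; idc.
have -> : iX ⊙ (((c ⊙ iX) • (iX ⊙ c) • (dX ⊙ iY)) ⊙ dY) =
    (iX ⊙ c ⊙ iX ⊙ iY ⊙ iY) • (iX ⊙ iX ⊙ c ⊙ iY ⊙ iY) • ((iX ⊙ dX) ⊙ (iY ⊙ dY)).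
  transitivity ((iX ⊙ (c ⊙ iX) ⊙ ⟦idm (Y ⊗ Y)⟧) • (iX ⊙ (iX ⊙ c) ⊙ ⟦idm (Y ⊗ Y)⟧) •
      (iX ⊙ (dX ⊙ iY) ⊙ dY)); first by par.
  by rewrite pk_id_tens -!atensA.
have -> : dX ⊙ (((iY ⊙ c) • (c ⊙ iY) • (iX ⊙ dY)) ⊙ iY) =
    (iX ⊙ iX ⊙ iY ⊙ c ⊙ iY) • (iX ⊙ iX ⊙ c ⊙ iY ⊙ iY) • ((dX ⊙ iX) ⊙ (dY ⊙ iY)).
  transitivity ((⟦idm (X ⊗ X)⟧ ⊙ (iY ⊙ c) ⊙ iY) • (⟦idm (X ⊗ X)⟧ ⊙ (c ⊙ iY) ⊙ iY) •
      (dX ⊙ (iX ⊙ dY) ⊙ iY)); first by par.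
  by rewrite pk_id_tens -!atensA.
rewrite !acompA -!acompA.
rewrite [in LHS](@interchange _ (iX ⊙ dX) dX); [|ty|ty].
rewrite [in RHS](@interchange _ (dX ⊙ iX) dX); [|ty|ty].
rewrite !pk_deltaA !acompA.
congr (_ • _ • _).
(* the two outer crossings act on disjoint strands *)
transitivity ((iX ⊙ ⟦idm (Y ⊗ X)⟧ ⊙ c ⊙ iY) • (iX ⊙ c ⊙ ⟦idm (X ⊗ Y)⟧ ⊙ iY)).
  by rewrite !pk_id_tens -!atensA.
transitivity ((iX ⊙ c ⊙ ⟦idm (Y ⊗ X)⟧ ⊙ iY) • (iX ⊙ ⟦idm (X ⊗ Y)⟧ ⊙ c ⊙ iY)).
  by par.
by rewrite !pk_id_tens -!atensA.
Qed.

End TensorCoalgebra.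

(** * The map Gamma of a pair of actions *)

Section Gamma.
Variables (C : strict_braided) (A H : hopf_algebra C).
Variables (phiH : module_algebra A H) (pi : inv_cocycle phiH).
Variables (M : C) (psi1 : hom (H ⊗ M) M) (psi1P : is_lmodule (hopf H) psi1).

Local Notation q := ⟦iso_inv pi⟧.
Local Notation iH := ⟦idm (carrier H)⟧.
Local Notation iM := ⟦idm M⟧.
Local Notation mH := ⟦μ[H]⟧.
Local Notation dH := ⟦δ[H]⟧.
Local Notation uH := ⟦η[H]⟧.
Local Notation eH := ⟦ε[H]⟧.
Local Notation lH := ⟦λ[H]⟧.
Local Notation f := ⟦ma_act phiH⟧.
Local Notation mP := ⟦mu_pi pi⟧.
Local Notation cHH := ⟦iso_hom (braid (carrier H) (carrier H))⟧.
Local Notation hf := (f • (q ⊙ iH)).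
Local Notation P1 := ⟦psi1⟧.

Lemma psi1_unit : P1 • (uH ⊙ iM) = iM.
Proof. exact: lmodule1 psi1P. Qed.

Lemma psi1A : P1 • (iH ⊙ P1) = P1 • (mH ⊙ iM).
Proof. exact: lmoduleA psi1P. Qed.

(** Composing the antipode with a coalgebra map [x] gives the convolution inverse
of [x]. *)
Lemma antipode_conv D d e x : typed d D (D ⊗ D) -> typed e D K -> typed x D H ->
  dH • x = (x ⊙ x) • d -> eH • x = e -> mH • ((lH • x) ⊙ x) • d = uH • e.
Proof.
move=> dT eT xT dx ex.
have -> : (lH • x) ⊙ x = (lH ⊙ iH) • (x ⊙ x) by par.
by rewrite -!acompA -dx !acompA antipodelH -acompA ex.
Qed.

Lemma antipode_cancel_l X s : typed s (H ⊗ X) M ->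
  P1 • (lH ⊙ (P1 • (iH ⊙ s) • (dH ⊙ ⟦idm X⟧))) • (dH ⊙ ⟦idm X⟧) = s.
Proof.
move=> sT; apply: (@conv_cancel _ _ _ _ _ psi1P H X dH eH lH iH s) => //; try ty.
- by rewrite deltaAH.
- by rewrite delta1H.
- by rewrite antipodelH.
Qed.

Lemma antipode_cancel_r X s : typed s (H ⊗ X) M ->
  P1 • (iH ⊙ (P1 • (lH ⊙ s) • (dH ⊙ ⟦idm X⟧))) • (dH ⊙ ⟦idm X⟧) = s.
Proof.
move=> sT; apply: (@conv_cancel _ _ _ _ _ psi1P H X dH eH iH lH s) => //; try ty.
- by rewrite deltaAH.
- by rewrite delta1H.
- by rewrite -!pk_tens -!pk_scomp; congr pk; apply: antipoder.
Qed.

(** Splits off the factor [h1] hidden in [mu_pi (h, k) = mu (h1, hf (h2, k))], so that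
[antipode_cancel_l] applies to both sides of the brace compatibility. *)
Lemma mu_pi_twist g : typed g (H ⊗ M) M ->
  P1 • (mP ⊙ g) • (iH ⊙ cHH ⊙ iM) • (dH ⊙ iH ⊙ iM) =
  P1 • (iH ⊙ (P1 • (hf ⊙ g) • (iH ⊙ cHH ⊙ iM) • (dH ⊙ iH ⊙ iM))) • (dH ⊙ iH ⊙ iM).
Proof.
move=> gT.
have -> : iH ⊙ (P1 • (hf ⊙ g) • (iH ⊙ cHH ⊙ iM) • (dH ⊙ iH ⊙ iM)) =
  (iH ⊙ P1) • (iH ⊙ hf ⊙ g) • (iH ⊙ iH ⊙ cHH ⊙ iM) • (iH ⊙ dH ⊙ iH ⊙ iM) by par.
rewrite !acompA psi1A -!acompA.
have -> : (iH ⊙ dH ⊙ iH ⊙ iM) • (dH ⊙ iH ⊙ iM) =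
          (dH ⊙ iH ⊙ iH ⊙ iM) • (dH ⊙ iH ⊙ iM).
  by rewrite !atensA; par; rewrite deltaAH.
have -> : (iH ⊙ iH ⊙ cHH ⊙ iM) • ((dH ⊙ iH ⊙ iH ⊙ iM) • (dH ⊙ iH ⊙ iM)) =
  (dH ⊙ iH ⊙ iH ⊙ iM) • ((iH ⊙ cHH ⊙ iM) • (dH ⊙ iH ⊙ iM)).
  rewrite !acompA; congr (_ • _).
  rewrite (atensA iH iH (cHH ⊙ iM)) (atensA iH iH iM) -!pk_id_tens; by par.
rewrite !acompA mu_piE; congr (_ • _ • _).
rewrite -!acompA; congr (_ • _).
rewrite (atensA iH hf g) (atensA dH iH) -pk_id_tens.
by par.
Qed.

Variables (psi2 : hom (H ⊗ M) M) (psi2P : is_lmodule (hopf_pi pi) psi2).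
Local Notation P2 := ⟦psi2⟧.
Local Notation G := ⟦gamma_act (coalg H) λ[H] psi1 psi2⟧.

Lemma psi2_unit : P2 • (uH ⊙ iM) = iM.
Proof. exact: lmodule1 psi2P. Qed.

Lemma psi2A : P2 • (iH ⊙ P2) = P2 • (mP ⊙ iM).
Proof. exact: lmoduleA psi2P. Qed.

Lemma pk_gamma : G = P1 • (lH ⊙ P2) • (dH ⊙ iM).
Proof. by rewrite !pk_scomp !pk_tens. Qed.

Lemma psi2_gamma : P2 = P1 • (iH ⊙ G) • (dH ⊙ iM).
Proof. by rewrite pk_gamma antipode_cancel_r //; ty. Qed.

Lemma gamma_unique g : typed g (H ⊗ M) M -> P2 = P1 • (iH ⊙ g) • (dH ⊙ iM) -> G = g.
Proof. by move=> gT E; rewrite pk_gamma E antipode_cancel_l. Qed.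

(** Both sides of the first equation have the form [psi1 (h1, s (h2, k, m))], by
[psi2_gamma] and [mu_pi_twist]; the second equation compares the two [s]. *)
Lemma brace_compat_gamma :
  P2 • (iH ⊙ P1) = P1 • (mP ⊙ G) • (iH ⊙ cHH ⊙ iM) • (dH ⊙ iH ⊙ iM) <->
  G • (iH ⊙ P1) = P1 • (hf ⊙ G) • (iH ⊙ cHH ⊙ iM) • (dH ⊙ iH ⊙ iM).
Proof.
have psi2E : P2 • (iH ⊙ P1) = P1 • (iH ⊙ (G • (iH ⊙ P1))) • (dH ⊙ iH ⊙ iM).
  rewrite {1}psi2_gamma -!acompA; congr (_ • _).
  have -> : (dH ⊙ iM) • (iH ⊙ P1) = (iH ⊙ iH ⊙ P1) • (dH ⊙ iH ⊙ iM).
    by rewrite (atensA iH) -!pk_id_tens; par.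
  by rewrite acompA; par.
rewrite psi2E mu_pi_twist; last ty.
split=> [E|-> //].
set s := RHS.
rewrite -[s](@antipode_cancel_l (H ⊗ M)) /s; last ty.
rewrite pk_id_tens -E -pk_id_tens antipode_cancel_l //; ty.
Qed.

(** From [m = psi2 (1, m) = psi1 (1, Gamma (1, m)) = Gamma (1, m)]. *)
Lemma gamma_unit : G • (uH ⊙ iM) = iM.
Proof.
have delta_etaH : dH • uH = uH ⊙ uH.
  by rewrite -!pk_tens -!pk_scomp; apply/eqmP; apply: delta_eta.
rewrite -{2}psi2_unit psi2_gamma -!acompA.
rewrite (@interchange _ dH uH iM iM); [|ty|ty].
rewrite delta_etaH -atensA; par.
have -> : uH ⊙ (G • (uH ⊙ iM)) = (uH ⊙ iM) • (G • (uH ⊙ iM)).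
  by rewrite -{2}[G • _]aten1m; par.
by rewrite acompA psi1_unit; idc.
Qed.

(** The two sides agree once [mu_pi (h1, k1)] acts on them through [psi1], both
being [psi2 (h, psi2 (k, m))]; [conv_cancel] on the coalgebra [H ⊗ H] then removes
the factor [mu_pi (h1, k1)]. *)
Lemma gammaA :
  P2 • (iH ⊙ P1) = P1 • (mP ⊙ G) • (iH ⊙ cHH ⊙ iM) • (dH ⊙ iH ⊙ iM) ->
  G • (iH ⊙ G) = G • (mP ⊙ iM).
Proof.
move=> compat.
pose d := tensor_delta (coalg H) (coalg H).
have dT : typed d (H ⊗ H) ((H ⊗ H) ⊗ (H ⊗ H)) := tensor_deltaT _ _.
have eT := tensor_epsT (coalg H) (coalg H).
have mP_delta : dH • mP = (mP ⊙ mP) • d.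
  rewrite /d /tensor_delta acompA.
  by rewrite -!pk_tens -!pk_scomp; congr pk; apply: delta_mu_pi.
have mP_eps : eH • mP = tensor_eps (coalg H) (coalg H).
  by rewrite /tensor_eps -!pk_tens -!pk_scomp; apply/eqmP; apply: eps_mu_pi.
have cancel s : typed s ((H ⊗ H) ⊗ M) M ->
    P1 • ((lH • mP) ⊙ (P1 • (mP ⊙ s) • (d ⊙ iM))) • (d ⊙ iM) = s.
  move=> sT.
  apply: (@conv_cancel _ _ _ _ _ psi1P (H ⊗ H) M d _ (lH • mP) mP s dT eT) => //.
  all: try ty.
  - exact: tensor_deltaA.
  - exact: tensor_delta1.
  - by apply: antipode_conv => //; ty.
rewrite -[LHS]cancel; last ty.
rewrite -[RHS]cancel; last ty.
congr (_ • (_ ⊙ _) • _).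
transitivity (P2 • (iH ⊙ P2)).
  rewrite {2}psi2_gamma.
  have -> : iH ⊙ (P1 • (iH ⊙ G) • (dH ⊙ iM)) =
      (iH ⊙ P1) • (iH ⊙ iH ⊙ G) • (iH ⊙ dH ⊙ iM) by par.
  rewrite !acompA compat /d /tensor_delta.
  have -> : mP ⊙ (G • (iH ⊙ G)) = (mP ⊙ G) • (iH ⊙ iH ⊙ iH ⊙ G).
    by rewrite (atensA iH iH) -pk_id_tens; par.
  have -> : ((iH ⊙ cHH ⊙ iH) • (dH ⊙ dH)) ⊙ iM =
      (iH ⊙ cHH ⊙ iH ⊙ iM) • (dH ⊙ dH ⊙ iM).
    transitivity (((iH ⊙ cHH ⊙ iH) ⊙ iM) • ((dH ⊙ dH) ⊙ iM)); first by par.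
    by rewrite -!atensA.
  rewrite !acompA -!(acompA (P1 • _)); congr (_ • _).
  rewrite -!acompA (acompA (iH ⊙ iH ⊙ iH ⊙ G)).
  have -> : (iH ⊙ iH ⊙ iH ⊙ G) • (iH ⊙ cHH ⊙ iH ⊙ iM) =
      (iH ⊙ cHH ⊙ iM) • (iH ⊙ iH ⊙ iH ⊙ G).
    by rewrite (atensA iH iH G) -!pk_id_tens; par.
  rewrite -!acompA; congr (_ • _).
  rewrite (atensA iH iH (iH ⊙ G)) -!pk_id_tens; by par.
rewrite psi2A psi2_gamma -acompA (@interchange _ dH mP iM iM); [|ty|ty].
rewrite mP_delta; idc.
have -> : mP ⊙ (G • (mP ⊙ iM)) = (iH ⊙ G) • ((mP ⊙ mP) ⊙ iM).
  by rewrite -atensA; par.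
by rewrite -!acompA; par.
Qed.
End Gamma.

(** * From cocycle modules to brace modules *)

Section Functors.
Variables (C : strict_braided) (A H : hopf_algebra C).
Variables (phiH : module_algebra A H) (pi : inv_cocycle phiH).

Local Notation p := ⟦iso_hom pi⟧.
Local Notation q := ⟦iso_inv pi⟧.
Local Notation iA := ⟦idm (carrier A)⟧.
Local Notation iH := ⟦idm (carrier H)⟧.
Local Notation mA := ⟦μ[A]⟧.
Local Notation dA := ⟦δ[A]⟧.
Local Notation dH := ⟦δ[H]⟧.
Local Notation f := ⟦ma_act phiH⟧.
Local Notation mP := ⟦mu_pi pi⟧.
Local Notation cAH := ⟦iso_hom (braid (carrier A) (carrier H))⟧.
Local Notation cHH := ⟦iso_hom (braid (carrier H) (carrier H))⟧.
Local Notation hf := (f • (q ⊙ iH)).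

(** [p] is an algebra map from [A] to [H] with the product [mu_pi]. *)
Lemma lmodule_pullback M (act : hom (H ⊗ M) M) :
  is_lmodule (hopf_pi pi) act -> is_lmodule (hopf A) (act ∘ (pi ⊠ idm M)).
Proof.
move=> actP.
have act1 : ⟦act⟧ • (⟦η[H]⟧ ⊙ ⟦idm M⟧) = ⟦idm M⟧ := lmodule1 actP.
have actA : ⟦act⟧ • (iH ⊙ ⟦act⟧) = ⟦act⟧ • (mP ⊙ ⟦idm M⟧) := lmoduleA actP.
split; apply/eqmP; rewrite !pk_scomp !pk_tens ?pk_scomp ?pk_tens.
  by rewrite -acompA; par; rewrite (eta_pi pi).
rewrite -[mu (hopf A)]/(μof A).
have mulp : p • mA = mP • (p ⊙ p).
  by rewrite pk_mu_pi -!acompA; par; rewrite !qp -pk_id_tens; idc.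
rewrite -!acompA; par; rewrite mulp.
have -> : p ⊙ (⟦act⟧ • (p ⊙ ⟦idm M⟧)) = (iH ⊙ ⟦act⟧) • (p ⊙ p ⊙ ⟦idm M⟧) by par.
rewrite !acompA actA -!acompA atensA; by par.
Qed.

Lemma lmodule_transport M N (act : hom (A ⊗ N) N) (g : iso N M) :
  is_lmodule (hopf A) act ->
  is_lmodule (hopf_pi pi) (g ∘ act ∘ (iso_inv pi ⊠ iso_inv g)).
Proof.
move=> actP.
have act1 : ⟦act⟧ • (⟦η[A]⟧ ⊙ ⟦idm N⟧) = ⟦idm N⟧ := lmodule1 actP.
have actA : ⟦act⟧ • (iA ⊙ ⟦act⟧) = ⟦act⟧ • (mA ⊙ ⟦idm N⟧) := lmoduleA actP.
have gK : ⟦iso_inv g⟧ • ⟦iso_hom g⟧ = ⟦idm N⟧ by rewrite acompE iso_homK.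
have Kg : ⟦iso_hom g⟧ • ⟦iso_inv g⟧ = ⟦idm M⟧ by rewrite acompE iso_invK.
split; apply/eqmP; last first.
  (* [mu_pi] unfolds to a composite, so it is generalized to stay packed *)
  rewrite -[mu (hopf_pi pi)]/(mu_pi pi); move: (mu_pi pi) (pk_mu_pi pi) => m mE.
  rewrite !pk_scomp !pk_tens !pk_scomp !pk_tens.
  have mulq : q • ⟦m⟧ = mA • (q ⊙ q) by rewrite mE !acompA qp; idc.
  rewrite -!acompA; par; rewrite mulq !acompA gK; idc.
  have -> : q ⊙ (⟦act⟧ • (q ⊙ ⟦iso_inv g⟧)) =
      (iA ⊙ ⟦act⟧) • (q ⊙ q ⊙ ⟦iso_inv g⟧) by par.
  have -> : (mA • (q ⊙ q)) ⊙ ⟦iso_inv g⟧ = (mA ⊙ ⟦idm N⟧) • (q ⊙ q ⊙ ⟦iso_inv g⟧).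
    by rewrite atensA; par.
  by rewrite !acompA -!(acompA ⟦iso_hom g⟧) actA.
rewrite !pk_scomp !pk_tens.
rewrite -[eta (hopf_pi pi)]/(ηof H) -acompA; par; rewrite (eta_pi_inv pi).
have -> : ⟦η[A]⟧ ⊙ ⟦iso_inv g⟧ = (⟦η[A]⟧ ⊙ ⟦idm N⟧) • ⟦iso_inv g⟧.
  by rewrite -{2}[⟦iso_inv g⟧]aten1m; par.
by rewrite -acompA (acompA ⟦act⟧) act1; idc; exact: Kg.
Qed.

(** The second equation is the first one precomposed with the isomorphism [q] on
the first strand, since [q] is a coalgebra map and slides through the braiding. *)
Lemma action_compat M (P1 : hom (H ⊗ M) M) (F : hom (A ⊗ M) M) :
  ⟦F⟧ • (iA ⊙ ⟦P1⟧) =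
    ⟦P1⟧ • (f ⊙ ⟦F⟧) • (iA ⊙ cAH ⊙ ⟦idm M⟧) • (dA ⊙ iH ⊙ ⟦idm M⟧) <->
  ⟦F⟧ • (q ⊙ ⟦idm M⟧) • (iH ⊙ ⟦P1⟧) =
    ⟦P1⟧ • (hf ⊙ (⟦F⟧ • (q ⊙ ⟦idm M⟧))) • (iH ⊙ cHH ⊙ ⟦idm M⟧) • (dH ⊙ iH ⊙ ⟦idm M⟧).
Proof.
have -> : ⟦F⟧ • (q ⊙ ⟦idm M⟧) • (iH ⊙ ⟦P1⟧) =
    ⟦F⟧ • (iA ⊙ ⟦P1⟧) • (q ⊙ iH ⊙ ⟦idm M⟧).
  by rewrite -pk_id_tens; par.
have -> : ⟦P1⟧ • (hf ⊙ (⟦F⟧ • (q ⊙ ⟦idm M⟧))) • (iH ⊙ cHH ⊙ ⟦idm M⟧) •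
      (dH ⊙ iH ⊙ ⟦idm M⟧) =
    ⟦P1⟧ • (f ⊙ ⟦F⟧) • (iA ⊙ cAH ⊙ ⟦idm M⟧) • (dA ⊙ iH ⊙ ⟦idm M⟧) •
      (q ⊙ iH ⊙ ⟦idm M⟧).
  rewrite -[RHS]acompA (@interchange _ dA q); [|ty|ty].
  rewrite delta_pi_inv -pk_id_tens; idc.
  have -> : ((q ⊙ q) • dH) ⊙ ⟦idm (H ⊗ M)⟧ =
      (q ⊙ q ⊙ iH ⊙ ⟦idm M⟧) • (dH ⊙ ⟦idm (H ⊗ M)⟧).
    by rewrite atensA -pk_id_tens; par.
  rewrite !acompA; congr (_ • _).
  have swap : cAH • (q ⊙ iH) = (iH ⊙ q) • cHH.
    by rewrite (@abraid_nat _ q iH H A H H) //; ty.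
  rewrite -!acompA (atensA q iH); par; rewrite swap.
  have -> : q ⊙ (((iH ⊙ q) • cHH) ⊙ ⟦idm M⟧) =
      (q ⊙ iH ⊙ q ⊙ ⟦idm M⟧) • (iH ⊙ cHH ⊙ ⟦idm M⟧).
    by rewrite (atensA iH q); par.
  rewrite (atensA q iH) !acompA; by par.
split=> [-> //|E].
have qpK Z (a : option (arrow C)) : typed a (A ⊗ Z) M ->
    a • (q ⊙ ⟦idm Z⟧) • (p ⊙ ⟦idm Z⟧) = a.
  by move=> aT; par; rewrite qp -pk_id_tens; idc.
rewrite -[LHS](@qpK (H ⊗ M)); last ty.
by rewrite pk_id_tens E -pk_id_tens qpK //; ty.
Qed.

Section OfCocycle.
Variable X : cocycle_module pi.
Local Notation M := (cm_M X).
Local Notation N := (cm_N X).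
Local Notation iM := ⟦idm M⟧.
Local Notation P1 := ⟦cm_varphiM X⟧.
Local Notation F := ⟦cm_phiM X⟧.
Local Notation g := ⟦iso_hom (cm_gamma X)⟧.
Local Notation g' := ⟦iso_inv (cm_gamma X)⟧.

Definition cm_psi2 : hom (H ⊗ M) M :=
  cm_gamma X ∘ cm_phiN X ∘ (iso_inv pi ⊠ iso_inv (cm_gamma X)).

(** This is the equation defining [gamma] in a cocycle module, carried to [H] and
[M]. *)
Lemma cm_psi2E : ⟦cm_psi2⟧ = P1 • (iH ⊙ (F • (q ⊙ iM))) • (dH ⊙ iM).
Proof.
have gg' : g • g' = iM by rewrite acompE iso_invK.
rewrite /cm_psi2 cm_gamma_mul !pk_scomp !pk_tens -!acompA; congr (_ • _).
par; rewrite delta_pi_inv gg'.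
have -> : ((q ⊙ q) • dH) ⊙ iM = (q ⊙ q ⊙ iM) • (dH ⊙ iM).
  by rewrite atensA; par.
by rewrite acompA; par; rewrite pq.
Qed.

Local Notation G := ⟦gamma_act (coalg H) λ[H] (cm_varphiM X) cm_psi2⟧.

Lemma cm_gammaE : G = F • (q ⊙ iM).
Proof.
by apply: (gamma_unique (cm_varphiM_lmod X)); [ty | rewrite cm_psi2E].
Qed.

Lemma cm_brace_compat :
  ⟦cm_psi2⟧ • (iH ⊙ P1) = P1 • (mP ⊙ G) • (iH ⊙ cHH ⊙ iM) • (dH ⊙ iH ⊙ iM).
Proof.
apply/(brace_compat_gamma pi (cm_varphiM_lmod X)); rewrite cm_gammaE.
apply/action_compat.
by have := cm_compat X; move/(f_equal (@pk _ _ _)); rewrite !pk_scomp !pk_tens.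
Qed.

Lemma cm_brace_law :
  cm_psi2 ∘ (idm H ⊠ cm_varphiM X) =
  cm_varphiM X ∘ (mu_pi pi ⊠ gamma_act (coalg H) λ[H] (cm_varphiM X) cm_psi2)
    ∘ (idm H ⊠ braid H H ⊠ idm M) ∘ (delta (coalg H) ⊠ idm H ⊠ idm M).
Proof.
apply: pk_inj; have := cm_brace_compat.
(* [mu_pi] and [gamma_act] unfold to composites; generalizing keeps them packed *)
move: cm_psi2 (gamma_act _ _ _ _) (mu_pi pi) => psi2 ga m E.
by rewrite !pk_scomp !pk_tens E.
Qed.

Definition brace_of_cocycle : brace_module (brace_pi pi) :=
  @BraceModule C (brace_pi pi) M (cm_varphiM X) cm_psi2
    (cm_varphiM_lmod X) (lmodule_transport (cm_gamma X) (cm_phiN_lmod X))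
    cm_brace_law.
End OfCocycle.

Lemma is_lmodule_morP (B M M' : C) (act : hom (B ⊗ M) M) (act' : hom (B ⊗ M') M') h :
  is_lmodule_mor act act' h <-> ⟦h⟧ • ⟦act⟧ = ⟦act'⟧ • (⟦idm B⟧ ⊙ ⟦h⟧).
Proof.
rewrite /is_lmodule_mor -pk_tens -!pk_scomp.
by split=> [->|/pk_inj].
Qed.

(** This square gives both the linearity of morphisms for the transported actions and
the naturality of the unit isomorphism. *)
Lemma gamma_inv_nat (X Y : cocycle_module pi) (u : cocycle_module_hom X Y) :
  comp (cmh_l u) (iso_inv (cm_gamma X)) = comp (iso_inv (cm_gamma Y)) (cmh_h u).
Proof.
have gu : comp (cmh_h u) (cm_gamma X) = comp (cm_gamma Y) (cmh_l u) := cmh_gamma u.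
by rewrite -[cmh_h u]compm1 -(iso_invK (cm_gamma X)) !compA -(compA _ (cmh_h u)) gu
  !compA iso_homK comp1m.
Qed.

Lemma brace_of_cocycle_mor (X Y : cocycle_module pi) (u : cocycle_module_hom X Y) :
  is_lmodule_mor (cm_psi2 X) (cm_psi2 Y) (cmh_h u).
Proof.
have /is_lmodule_morP phiNu := cmh_phiN u.
have gu : ⟦cmh_h u⟧ • ⟦iso_hom (cm_gamma X)⟧ = ⟦iso_hom (cm_gamma Y)⟧ • ⟦cmh_l u⟧.
  by rewrite -!pk_scomp cmh_gamma.
have g'u : ⟦cmh_l u⟧ • ⟦iso_inv (cm_gamma X)⟧ = ⟦iso_inv (cm_gamma Y)⟧ • ⟦cmh_h u⟧.
  by rewrite !acompE gamma_inv_nat.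
apply/is_lmodule_morP; rewrite /cm_psi2 !pk_scomp !pk_tens !acompA gu.
rewrite -(acompA _ _ ⟦cm_phiN X⟧) phiNu -!acompA; par; by rewrite g'u.
Qed.

Definition brace_functor : functor (cocycle_module_cat pi) (brace_module_cat (brace_pi pi)).
Proof.
refine (@Functor (cocycle_module_cat pi) (brace_module_cat (brace_pi pi))
  brace_of_cocycle (fun X Y u => @BraceModuleHom C (brace_pi pi) (brace_of_cocycle X)
    (brace_of_cocycle Y) (cmh_h u) (cmh_varphiM u) (brace_of_cocycle_mor u)) _ _).
- by move=> X; apply: brace_module_hom_eq.
- by move=> X Y Z v u; apply: brace_module_hom_eq.
Defined.

(** * From brace modules to cocycle modules *)

Section OfBrace.
Variable X : brace_module (brace_pi pi).
Local Notation M := (bm_M X).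
Local Notation iM := ⟦idm M⟧.

(** The first action with its type stated over [H], to which the carrier of the
induced brace only reduces; likewise for the second action. *)
Definition br_psi1 : hom (H ⊗ M) M := bm_psi1 X.
Definition br_psi2 : hom (H ⊗ M) M := bm_psi2 X.
Definition br_gamma : hom (H ⊗ M) M := gamma_act (coalg H) λ[H] br_psi1 br_psi2.
Definition br_phiM : hom (A ⊗ M) M := br_gamma ∘ (pi ⊠ idm M).
Definition br_phiN : hom (A ⊗ M) M := br_psi2 ∘ (pi ⊠ idm M).
Local Notation G := ⟦br_gamma⟧.

Lemma br_psi1P : is_lmodule (hopf H) br_psi1.
Proof. exact: bm_psi1_lmod X. Qed.

Lemma br_psi2P : is_lmodule (hopf_pi pi) br_psi2.
Proof. exact: bm_psi2_lmod X. Qed.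

Lemma br_compat : ⟦br_psi2⟧ • (iH ⊙ ⟦br_psi1⟧) =
  ⟦br_psi1⟧ • (mP ⊙ G) • (iH ⊙ cHH ⊙ iM) • (dH ⊙ iH ⊙ iM).
Proof.
have E : br_psi2 ∘ (idm H ⊠ br_psi1) = br_psi1 ∘ (mu_pi pi ⊠ br_gamma)
    ∘ (idm H ⊠ braid H H ⊠ idm M) ∘ (δ[H] ⊠ idm H ⊠ idm M) := bm_compat X.
move/(f_equal (@pk _ _ _)): E; rewrite pk_scomp pk_tens => ->.
move: (mu_pi pi) br_gamma => m ga; by rewrite !pk_scomp !pk_tens.
Qed.

Lemma br_gamma_lmod : is_lmodule (hopf_pi pi) br_gamma.
Proof.
have G1 : G • (⟦η[H]⟧ ⊙ iM) = iM := gamma_unit br_psi1P br_psi2P.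
have GA : G • (iH ⊙ G) = G • (mP ⊙ iM) := gammaA br_psi1P br_psi2P br_compat.
split; apply/eqmP.
  rewrite -[eta (hopf_pi pi)]/(ηof H); move: br_gamma G1 => ga G1.
  by rewrite pk_scomp pk_tens G1.
rewrite -[mu (hopf_pi pi)]/(mu_pi pi); move: (mu_pi pi) br_gamma GA => m ga GA.
by rewrite !pk_scomp !pk_tens GA.
Qed.

Lemma br_cocycle_compat : br_phiM ∘ (idm A ⊠ br_psi1) =
  br_psi1 ∘ (phiH ⊠ br_phiM) ∘ (idm A ⊠ braid A H ⊠ idm M)
    ∘ (δ[A] ⊠ idm H ⊠ idm M).
Proof.
have FE : ⟦br_phiM⟧ • (q ⊙ iM) = G.
  by rewrite /br_phiM pk_scomp pk_tens; par; rewrite pq -pk_id_tens; idc.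
have := proj2 (action_compat br_psi1 br_phiM); rewrite FE => AC.
have /AC := proj1 (brace_compat_gamma pi br_psi1P br_psi2) br_compat.
move=> E; apply: pk_inj; move: br_phiM E => F E; by rewrite !pk_scomp !pk_tens E.
Qed.

(** As [gamma] is the identity here, this is [psi2_gamma] pulled back along [p]. *)
Lemma br_gamma_mul : idm M ∘ br_phiN =
  br_psi1 ∘ (pi ⊠ br_phiM) ∘ (δ[A] ⊠ idm M).
Proof.
have E : ⟦br_psi2⟧ = ⟦br_psi1⟧ • (iH ⊙ G) • (dH ⊙ iM).
  exact: psi2_gamma br_psi1P br_psi2.
apply: pk_inj; rewrite /br_phiN /br_phiM.
move: br_psi2 br_gamma E => psi2 ga E.
rewrite !pk_scomp !pk_tens !pk_scomp pk_tens E; idc.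
rewrite -!acompA; par; rewrite delta_pi; idc.
have -> : p ⊙ (⟦ga⟧ • (p ⊙ iM)) = (iH ⊙ ⟦ga⟧) • ((p ⊙ p) ⊙ iM).
  by rewrite -atensA; par.
by rewrite -!acompA; par.
Qed.

Definition iso_id (D : category) (Z : D) : iso Z Z :=
  Iso (comp1m (idm Z)) (comp1m (idm Z)).

Definition cocycle_of_brace : cocycle_module pi :=
  @CocycleModule C A H phiH pi M M br_phiM br_psi1 br_phiN (iso_id M)
    (lmodule_pullback br_gamma_lmod) br_psi1P br_cocycle_compat
    (lmodule_pullback br_psi2P) br_gamma_mul.

End OfBrace.

Lemma pullback_mor (M M' : C) (act : hom (H ⊗ M) M) (act' : hom (H ⊗ M') M') v :
  is_lmodule_mor act act' v ->
  is_lmodule_mor (act ∘ (pi ⊠ idm M)) (act' ∘ (pi ⊠ idm M')) v.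
Proof.
move=> /is_lmodule_morP E; apply/is_lmodule_morP; rewrite !pk_scomp !pk_tens.
by rewrite acompA E -!acompA; par.
Qed.

Section OfBraceMor.
Variables (X Y : brace_module (brace_pi pi)) (u : brace_module_hom X Y).
Local Notation h := ⟦bmh_h u⟧.

Lemma gamma_mor : is_lmodule_mor (br_gamma X) (br_gamma Y) (bmh_h u).
Proof.
have h1 : h • ⟦br_psi1 X⟧ = ⟦br_psi1 Y⟧ • (iH ⊙ h).
  by apply/is_lmodule_morP; exact: bmh_psi1 u.
have h2 : h • ⟦br_psi2 X⟧ = ⟦br_psi2 Y⟧ • (iH ⊙ h).
  by apply/is_lmodule_morP; exact: bmh_psi2 u.
apply/is_lmodule_morP; rewrite !pk_gamma !acompA h1.
rewrite -!acompA (acompA (iH ⊙ h)); par; rewrite h2.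
have -> : ⟦λ[H]⟧ ⊙ (⟦br_psi2 Y⟧ • (iH ⊙ h)) =
    (⟦λ[H]⟧ ⊙ ⟦br_psi2 Y⟧) • ((iH ⊙ iH) ⊙ h).
  by rewrite -atensA; par.
by rewrite -pk_id_tens -!acompA; par.
Qed.

Definition cocycle_of_brace_mor :
  cocycle_module_hom (cocycle_of_brace X) (cocycle_of_brace Y).
Proof.
refine (@CocycleModuleHom C A H phiH pi (cocycle_of_brace X) (cocycle_of_brace Y)
    (bmh_h u) (bmh_h u) (pullback_mor gamma_mor) (bmh_psi1 u) (pullback_mor (bmh_psi2 u)) _).
by rewrite /scomp /= comp1m compm1.
Defined.
End OfBraceMor.

Definition cocycle_functor : functor (brace_module_cat (brace_pi pi)) (cocycle_module_cat pi).
Proof.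
refine (@Functor (brace_module_cat (brace_pi pi)) (cocycle_module_cat pi)
  cocycle_of_brace cocycle_of_brace_mor _ _).
- by move=> X; apply: cocycle_module_hom_eq.
- by move=> X Y Z v u; apply: cocycle_module_hom_eq.
Defined.

(** * The two composites *)

Section Counit.
Variable X : brace_module (brace_pi pi).
Local Notation M := (bm_M X).

Lemma counit_psi2 : cm_psi2 (cocycle_of_brace X) = br_psi2 X.
Proof.
apply: pk_inj; rewrite /cm_psi2 /= /br_phiN !pk_scomp !pk_tens; idc.
by rewrite -acompA; par; rewrite pq -pk_id_tens; idc.
Qed.

Local Notation Y := (brace_of_cocycle (cocycle_of_brace X)).

Lemma counit_psi2_to : is_lmodule_mor (bm_psi2 Y) (bm_psi2 X) (idm M).
Proof. by rewrite /= counit_psi2; apply: is_lmodule_mor_id. Qed.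

Lemma counit_psi2_from : is_lmodule_mor (bm_psi2 X) (bm_psi2 Y) (idm M).
Proof. by rewrite /= counit_psi2; apply: is_lmodule_mor_id. Qed.

Definition counit_iso : @iso (brace_module_cat (brace_pi pi)) Y X.
Proof.
refine (@Iso (brace_module_cat (brace_pi pi)) Y X
  (@BraceModuleHom C (brace_pi pi) Y X (idm M) (is_lmodule_mor_id _) counit_psi2_to)
  (@BraceModuleHom C (brace_pi pi) X Y (idm M) (is_lmodule_mor_id _) counit_psi2_from)
  _ _); apply: brace_module_hom_eq; exact: comp1m.
Defined.
End Counit.

Section Unit.
Variable X : cocycle_module pi.
Local Notation M := (cm_M X).
Local Notation N := (cm_N X).
Local Notation g := (cm_gamma X).
Local Notation Y := (cocycle_of_brace (brace_of_cocycle X)).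

Lemma unit_phiM : br_phiM (brace_of_cocycle X) = cm_phiM X.
Proof.
apply: pk_inj; rewrite /br_phiM pk_scomp pk_tens cm_gammaE; par.
by rewrite qp -pk_id_tens; idc.
Qed.

Lemma unit_phiN : br_phiN (brace_of_cocycle X) ∘ (idm A ⊠ g) = g ∘ cm_phiN X.
Proof.
have g'g : ⟦iso_inv g⟧ • ⟦iso_hom g⟧ = ⟦idm N⟧ by rewrite acompE iso_homK.
apply: pk_inj; rewrite /br_phiN /= /br_psi2 /= /cm_psi2 !pk_scomp !pk_tens.
by rewrite -!acompA; par; rewrite qp g'g -pk_id_tens; idc.
Qed.

Lemma unit_phiN_inv : iso_inv g ∘ br_phiN (brace_of_cocycle X) =
  cm_phiN X ∘ (idm A ⊠ iso_inv g).
Proof.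
have g'g : ⟦iso_inv g⟧ • ⟦iso_hom g⟧ = ⟦idm N⟧ by rewrite acompE iso_homK.
apply: pk_inj; rewrite /br_phiN /= /br_psi2 /= /cm_psi2 !pk_scomp !pk_tens.
rewrite !acompA g'g; idc; rewrite -acompA; par; by rewrite qp.
Qed.

Lemma unit_phiM_to : is_lmodule_mor (cm_phiM Y) (cm_phiM X) (idm M).
Proof. by rewrite /= unit_phiM; apply: is_lmodule_mor_id. Qed.

Lemma unit_phiM_from : is_lmodule_mor (cm_phiM X) (cm_phiM Y) (idm M).
Proof. by rewrite /= unit_phiM; apply: is_lmodule_mor_id. Qed.

Lemma unit_gamma_to : idm M ∘ cm_gamma Y = g ∘ iso_inv g.
Proof. by rewrite /scomp /= comp1m iso_invK. Qed.

(** Passing to brace modules and back replaces [N] by [M], so the isomorphism is the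
identity on [M] and the inverse of [gamma] on the other component. *)
Definition unit_iso : @iso (cocycle_module_cat pi) Y X.
Proof.
refine (@Iso (cocycle_module_cat pi) Y X
  (@CocycleModuleHom C A H phiH pi Y X (idm M) (iso_inv g)
    unit_phiM_to (is_lmodule_mor_id _) unit_phiN_inv unit_gamma_to)
  (@CocycleModuleHom C A H phiH pi X Y (idm M) g
    unit_phiM_from (is_lmodule_mor_id _) (eq_sym unit_phiN) (eq_refl _))
  _ _); apply: cocycle_module_hom_eq; rewrite /= ?comp1m ?iso_homK ?iso_invK //.
Defined.
End Unit.

End Functors.

(** * The equivalence *)

Theorem theorem2p26 (C : strict_braided) (A H : hopf_algebra C)
    (phiH : module_algebra A H) (pi : inv_cocycle phiH) :
  equivalent_categories (cocycle_module_cat pi) (brace_module_cat (brace_pi pi)).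
Proof.
exists (brace_functor pi), (cocycle_functor pi); split; constructor.
  refine (@NatIso _ _ (functor_comp (cocycle_functor pi) (brace_functor pi))
    (functor_id _) (@unit_iso C A H phiH pi) _).
  move=> X Y u; apply: cocycle_module_hom_eq.
    exact: eq_trans (comp1m (cmh_h u)) (eq_sym (compm1 (cmh_h u))).
  exact: eq_sym (gamma_inv_nat u).
refine (@NatIso _ _ (functor_comp (brace_functor pi) (cocycle_functor pi))
  (functor_id _) (@counit_iso C A H phiH pi) _).
move=> X Y u; apply: brace_module_hom_eq.
exact: eq_trans (comp1m (bmh_h u)) (eq_sym (compm1 (bmh_h u))).
Qed.
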